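(* Let $k$ be an algebraically closed field of characteristic zero, let $n\ge 2$, and let $C$ be the smooth projective curve over $k$ with affine model $y^n=h(x)$, where $h\in k[x]$ is separable of degree $m\ge 2$, and suppose that $C$ has genus $g\ge 2$. Let $P$ be a point of $C$ above a root of $h$ (that is, a point with $x(P)$ a root of $h$). Then $P$ is a Weierstrass point of $C$ if and only if $m\ge 3$. If $m=2$, the vanishing sequence of $H^0(C,\Omega^1)$ at $P$ is $(0,1,\dots,g-1)$.
   Context: The vanishing sequence of $H^0(C,\Omega^1)$ at a point $P$ is the increasing sequence of the $g$ orders $\operatorname{ord}_P(\omega)$ taken by non-zero holomorphic differentials $\omega$ on $C$. In characteristic zero it equals the generic sequence $(0,1,\dots,g-1)$ for all but finitely many points; $P$ is a Weierstrass point when its vanishing sequence differs from $(0,1,\dots,g-1)$. *)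

(* Defs.v *)
From HB Require Import structures.
From mathcomp Require Import all_boot all_order all_algebra all_field.

Set Implicit Arguments.
Unset Strict Implicit.
Unset Printing Implicit Defensive.

Import Order.TTheory GRing.Theory Num.Theory.
Local Open Scope ring_scope.

(** A smooth projective curve over an algebraically closed field k is handled
    through its function field K, an extension of k given by a morphism
    [emb : k -> K]: the closed points of the curve are the normalized discrete
    valuations of K that are trivial on k (abstract nonsingular curves,
    Hartshorne I.6), and rational differentials are the Kaehler differentials
    of K over k. *)

(** In {poly {poly k}} the outer variable stands for Y, the inner one for X. *)
Definition evalXY (k K : fieldType) (emb : {rmorphism k -> K}) (x y : K)
    (p : {poly {poly k}}) : K :=
  (map_poly (map_poly emb) p).[y%:P].[x].

(** K is the fraction field of k[X, Y] / (Y ^ n - h(X)), where x and y are the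
    classes of X and Y. *)
Definition function_field_of (k K : fieldType) (emb : {rmorphism k -> K})
    (x y : K) (n : nat) (h : {poly k}) : Prop :=
  (forall p : {poly {poly k}},
      evalXY emb x y p = 0 <-> exists q, p = q * ('X^n - h%:P)) /\
  (forall f : K, exists p q : {poly {poly k}},
      evalXY emb x y q != 0 /\ f = evalXY emb x y p / evalXY emb x y q).

(** The value [ord P 0] is unconstrained; [ord P f] is only meaningful for
    nonzero [f]. *)
Record point (k K : fieldType) (emb : {rmorphism k -> K}) := Point {
  ord :> K -> int;
  ordM : forall f f', f != 0 -> f' != 0 -> ord (f * f') = ord f + ord f';
  ordD : forall f f', f != 0 -> f' != 0 -> f + f' != 0 ->
    Num.min (ord f) (ord f') <= ord (f + f');
  ord_const : forall c : k, c != 0 -> ord (emb c) = 0;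
  ord_uniformizer : exists2 t, t != 0 & ord t = 1
}.

Section Differentials.
Variables (k K : fieldType) (emb : {rmorphism k -> K}).

Definition derivation (M : lmodType K) (D : K -> M) : Prop :=
  [/\ forall f f', D (f + f') = D f + D f',
      forall f f', D (f * f') = f *: D f' + f' *: D f
    & forall c : k, D (emb c) = 0].

(** [d : K -> Omega] is the universal k-derivation, i.e. Omega is the module
    of Kaehler differentials of K over k. *)
Definition kaehler (Omega : lmodType K) (d : K -> Omega) : Prop :=
  derivation d /\
  forall (M : lmodType K) (D : K -> M), derivation D ->
    exists phi : {linear Omega -> M},
      (forall f, phi (d f) = D f) /\
      (forall psi : {linear Omega -> M},
          (forall f, psi (d f) = D f) -> psi =1 phi).

Variables (Omega : lmodType K) (d : K -> Omega).

(** [w] is nonzero at [P] of order [e]: w = f dt with t a local parameter at P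
    and ord_P f = e. The value of e does not depend on t. *)
Definition diff_ord (P : point emb) (w : Omega) (e : int) : Prop :=
  exists t f : K, [/\ t != 0, P t = 1, f != 0, w = f *: d t & P f = e].

(** Membership in the space H^0(C, Omega^1) of global sections. *)
Definition holomorphic (w : Omega) : Prop :=
  w = 0 \/ forall P : point emb, exists2 e, 0 <= e & diff_ord P w e.

(** g = dim_k H^0(C, Omega^1): there is a k-basis of size g. *)
Definition has_genus (g : nat) : Prop :=
  exists b : 'I_g -> Omega,
    (forall i, holomorphic (b i)) /\
    forall w, holomorphic w ->
      exists! c : 'rV[k]_g, w = \sum_(i < g) emb (c 0 i) *: b i.

(** [g] is meant to be the genus; [s] lists in increasing order the g orders at
    P of the nonzero holomorphic differentials. *)
Definition vanishing_sequence (g : nat) (P : point emb) (s : seq int) : Prop :=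
  [/\ size s = g, sorted <%R s
    & forall e, e \in s <->
        exists w, [/\ w != 0, holomorphic w & diff_ord P w e]].

Definition generic_sequence (g : nat) : seq int := [seq Posz i | i <- iota 0 g].

Definition weierstrass_point (g : nat) (P : point emb) : Prop :=
  exists s, vanishing_sequence g P s /\ s <> generic_sequence g.

End Differentials.

(* Main.v *)
Require Import Defs.
From HB Require Import structures.
From mathcomp Require Import all_boot all_order all_algebra all_field.
From mathcomp Require Import zify ring.
From Stdlib Require Import Classical ClassicalEpsilon.

Set Implicit Arguments.
Unset Strict Implicit.
Unset Printing Implicit Defensive.

Import Order.TTheory GRing.Theory Num.Theory.
Local Open Scope ring_scope.

(** The function field is K = k(x, y). At a point above a finite non-root of h
    the function x - b is a local parameter, above a root b it is y, and at
    infinity it is t = x ^ A / y ^ B, where B m' = A n' + 1 and n = n' gcd(m, n),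
    m = m' gcd(m, n). This gives ord (dx) = 0, n - 1 and - (n' + 1) respectively,
    so that (x - a) ^ i y ^ l dx / y ^ (n - 1) is holomorphic whenever
    n (i + 1) < m (n - 1 - l).

    Conversely write a holomorphic differential as f dx, and f y ^ (n - 1) as
    (sum_(l < n) G_l(x) y ^ l) / D(x). The points needed to see that D divides
    every G_l and that deg G_l is small are obtained by deforming the valuation P
    we start from: if X and a Cauchy sequence Y_N in K satisfy Y_N ^ n -> h(X), then
    p(x, y) |-> lim P(p(X, Y_N)) is again a point. The Y_N come from Newton's
    iteration; averaging over their multiples by n-th roots of unity isolates
    each G_l.

    At the point P above the root a the monomial differential with exponents
    (i, l) has order n i + l, so the vanishing sequence consists of the q with
    n (q / n + 1) < m (n - 1 - q mod n). For m = 2 these are the q < (n - 1) / 2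
    (rounded down). For m >= 3 and g >= 2 the order n occurs but n - 1 does not. *)

(** * Valuations *)

Section Valuation.
Variables (k K : fieldType) (emb : {rmorphism k -> K}) (P : point emb).

Definition vge (i : int) (f : K) := (f == 0) || (i <= P f).

Lemma vgeE i f : f != 0 -> vge i f = (i <= P f).
Proof. by rewrite /vge => /negPf->. Qed.

Lemma vge0r i : vge i 0.
Proof. by rewrite /vge eqxx. Qed.

Lemma ord_one : P 1 = 0.
Proof. by rewrite -(rmorph1 emb) ord_const ?oner_eq0. Qed.

Lemma ordV f : f != 0 -> P f^-1 = - P f.
Proof.
move=> f0; apply/eqP; rewrite -addr_eq0 -ordM ?invr_eq0 //.
by rewrite mulVf // ord_one.
Qed.

Lemma ordN f : f != 0 -> P (- f) = P f.
Proof.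
move=> f0; rewrite -mulN1r ordM ?oppr_eq0 ?oner_eq0 //.
by rewrite -(rmorph1 emb) -rmorphN ord_const ?add0r // oppr_eq0 oner_eq0.
Qed.

Lemma ordX f i : f != 0 -> P (f ^+ i) = P f *+ i.
Proof.
move=> f0; elim: i => [|i IH]; first by rewrite expr0 ord_one.
by rewrite exprS ordM ?expf_neq0 // IH mulrS.
Qed.

Lemma ord_div f f' : f != 0 -> f' != 0 -> P (f / f') = P f - P f'.
Proof. by move=> f0 f'0; rewrite ordM ?invr_eq0 // ordV. Qed.

Lemma vgeW i j f : j <= i -> vge i f -> vge j f.
Proof.
by move=> ji /orP[/eqP->|h]; rewrite ?vge0r // /vge (le_trans ji h) orbT.
Qed.

Lemma vgeD i f f' : vge i f -> vge i f' -> vge i (f + f').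
Proof.
have [->|f0] := eqVneq f 0; first by rewrite add0r.
have [->|f'0] := eqVneq f' 0; first by rewrite addr0.
have [->|ff0] := eqVneq (f + f') 0; first by rewrite vge0r.
rewrite !vgeE // => h h'; apply: le_trans (ordD P f0 f'0 ff0).
by rewrite le_min h.
Qed.

Lemma vgeN i f : vge i (- f) = vge i f.
Proof.
have [->|f0] := eqVneq f 0; first by rewrite oppr0.
by rewrite !vgeE ?oppr_eq0 // ordN.
Qed.

Lemma vgeB i f f' : vge i f -> vge i f' -> vge i (f - f').
Proof. by move=> h h'; rewrite vgeD ?vgeN. Qed.

Lemma vgeM i j f f' : vge i f -> vge j f' -> vge (i + j) (f * f').
Proof.
have [->|f0] := eqVneq f 0; first by rewrite mul0r !vge0r.
have [->|f'0] := eqVneq f' 0; first by rewrite mulr0 !vge0r.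
by rewrite !vgeE ?mulf_neq0 // => h h'; rewrite ordM // lerD.
Qed.

Lemma vge_sum (I : Type) (r : seq I) (A : pred I) i (F : I -> K) :
  (forall a, A a -> vge i (F a)) -> vge i (\sum_(a <- r | A a) F a).
Proof.
by move=> h; elim/big_ind: _ => //; [exact: vge0r | exact: vgeD].
Qed.

Lemma vge_const c : vge 0 (emb c).
Proof.
have [->|c0] := eqVneq c 0; first by rewrite rmorph0 vge0r.
by rewrite vgeE ?fmorph_eq0 // ord_const.
Qed.

Lemma vge01 : vge 0 1.
Proof. by rewrite vgeE ?oner_eq0 // ord_one. Qed.

Lemma vgeX i f j : vge i f -> vge (i *+ j) (f ^+ j).
Proof.
move=> h; elim: j => [|j IH]; first by rewrite mulr0n vge01.
by rewrite exprS mulrS vgeM.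
Qed.

Lemma vgeX0 f j : vge 0 f -> vge 0 (f ^+ j).
Proof. by move=> /(@vgeX 0 f j); rewrite mul0rn. Qed.

Lemma vge_unitM i f f' : f != 0 -> P f = 0 -> vge i (f * f') = vge i f'.
Proof.
have [->|f'0] := eqVneq f' 0; first by rewrite mulr0.
by move=> f0 Pf; rewrite !vgeE ?mulf_neq0 // ordM // Pf add0r.
Qed.

(** The strict case of the ultrametric inequality: were the order of the sum larger than [P f], then
    [f], as the difference of the sum and [f'], would have order larger than its own. *)
Lemma ordDl f f' : f != 0 -> vge (P f + 1) f' ->
  f + f' != 0 /\ P (f + f') = P f.
Proof.
move=> f0 h; have ff0 : f + f' != 0.
  apply/eqP => /eqP; rewrite addr_eq0 => /eqP e; move: h.
  rewrite -vgeN -e vgeE //; lia.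
split=> //; apply/eqP; rewrite eq_le; apply/andP; split.
  rewrite leNgt; apply/negP => lt.
  have : vge (P f + 1) ((f + f') - f') by apply: vgeB h; rewrite vgeE //; lia.
  rewrite addrK vgeE //; lia.
by rewrite -vgeE //; apply: vgeD; [rewrite vgeE | apply: vgeW h; lia].
Qed.

Lemma vge_horner z (r : {poly k}) : vge 0 z -> vge 0 (map_poly emb r).[z].
Proof.
move=> hz; elim/poly_ind: r => [|r c IH]; first by rewrite rmorph0 horner0 vge0r.
rewrite rmorphD rmorphM /= map_polyX map_polyC /= !hornerE.
by rewrite vgeD ?vge_const // -[0]addr0 vgeM.
Qed.

(** [X - c] divides [r - r(c)], and the quotient takes a regular value at [z]. *)
Lemma horner_specialize z c (r : {poly k}) : vge 1 (z - emb c) ->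
  vge 1 ((map_poly emb r).[z] - emb r.[c]).
Proof.
move=> hz; have /factor_theorem[q e] : root (r - r.[c]%:P) c.
  by rewrite rootE !hornerE subrr.
have /(canRL (subrK _)) -> := e.
rewrite rmorphD rmorphM /= map_polyC /= map_polyXsubC hornerD hornerC.
rewrite hornerM hornerXsubC !hornerE subrr mulr0 add0r addrK.
rewrite -[1]add0r vgeM // vge_horner //.
by rewrite -[z](subrK (emb c)) vgeD ?vge_const // (vgeW _ hz).
Qed.

Lemma ord_unit_of_residue f c : c != 0 -> vge 1 (f - emb c) -> f != 0 /\ P f = 0.
Proof.
move=> c0 h; have := @ordDl (emb c) (f - emb c).
rewrite fmorph_eq0 c0 ord_const // add0r => /(_ isT h).
by rewrite addrC subrK.
Qed.

Lemma ord_horner_unit z c (r : {poly k}) : vge 1 (z - emb c) -> r.[c] != 0 ->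
  (map_poly emb r).[z] != 0 /\ P (map_poly emb r).[z] = 0.
Proof.
by move=> /horner_specialize h /ord_unit_of_residue; apply.
Qed.

(** At a pole of [z] the leading term dominates: each Horner step multiplies by [z], and the
    constant then added has larger order. *)
Lemma ord_horner_pole z (r : {poly k}) : z != 0 -> P z < 0 -> r != 0 ->
  (map_poly emb r).[z] != 0 /\ P (map_poly emb r).[z] = P z *+ (size r).-1.
Proof.
move=> z0 Pz; elim/poly_ind: r => [|r c IH]; first by rewrite eqxx.
rewrite rmorphD rmorphM /= map_polyX map_polyC /= !hornerE size_MXaddC.
have [->|r0] /= := eqVneq r 0.
  rewrite mul0r add0r rmorph0 horner0 mul0r add0r polyC_eq0 => c0.
  by rewrite (negPf c0) size_poly0 fmorph_eq0 c0 ord_const.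
move=> _; have [e0 e] := IH r0.
have sr : (0 < size r)%N by rewrite size_poly_gt0.
have -> : P z *+ size r = P ((map_poly emb r).[z] * z).
  by rewrite ordM // e addrC -mulrS prednK.
apply: ordDl; first by rewrite mulf_neq0.
apply: vgeW (vge_const c); rewrite ordM // e.
have : 0 <= - (P z *+ (size r).-1) by rewrite -mulNrn mulrn_wge0 //; lia.
lia.
Qed.

(** Split off the exact power of [X - b] from [r]; the cofactor does not vanish at [b] and so takes
    a unit value. This makes a perturbation of a constant transcendental over [k]. *)
Lemma ord_horner_zero z b (r : {poly k}) : z - emb b != 0 ->
  0 < P (z - emb b) -> r != 0 -> (map_poly emb r).[z] != 0.
Proof.
move=> zb0 Pzb r0; have [m [q qb e]] := multiplicity_XsubC r b.
rewrite r0 /= in qb; rewrite e rmorphM rmorphXn /= map_polyXsubC.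
rewrite hornerM horner_exp hornerXsubC mulf_neq0 ?expf_neq0 //.
have [] // := @ord_horner_unit z b q; first by rewrite vgeE //; lia.
Qed.

End Valuation.

(** Over an algebraically closed field [r] is a constant times a product of factors [X - c]. If no
    [z - c] had positive order, neither would the product. *)
Lemma residue_root (k : closedFieldType) (K : fieldType)
    (emb : {rmorphism k -> K}) (P : point emb) z (r : {poly k}) :
  r != 0 -> vge P 1 (map_poly emb r).[z] ->
  exists2 c, root r c & vge P 1 (z - emb c).
Proof.
move=> r0; have [s e] := closed_field_poly_normal r.
have rootE' : root r =1 mem s.
  by move=> c; rewrite /= e rootZ ?lead_coef_eq0 // root_prod_XsubC.
rewrite [in map_poly _ _]e map_polyZ hornerZ vge_unitM ?fmorph_eq0
  ?lead_coef_eq0 //; last first.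
  by rewrite ord_const ?lead_coef_eq0.
have {rootE'} : {subset s <= root r} by move=> c; rewrite /in_mem /= rootE'.
elim: s {e} => [|c s IH] hs; first by rewrite big_nil rmorph1 hornerC vgeE ?oner_eq0 ?ord_one.
rewrite big_cons rmorphM /= map_polyXsubC hornerM hornerXsubC => h.
have [hc|hc] := boolP (vge P 1 (z - emb c)).
  by exists c => //; exact: (hs c (mem_head c s)).
apply: IH => [a sa|]; first by apply: hs; rewrite inE sa orbT.
move: h hc; rewrite /vge !mulf_eq0 negb_or => /orP[/orP[->//|->//]|] h.
case/andP=> zc0 zc; case: eqP => //= /eqP p0; move: h; rewrite ordM // => h.
by rewrite -(lerD2l (P (z - emb c))); apply: le_trans h; lia.
Qed.

(** * Local parameters *)

Section LocalRing.
Variables (k K : fieldType) (emb : {rmorphism k -> K}) (P : point emb).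
Variables (t u : K).

(* A ring presentation of the valuation ring of [P]: it turns out to be all of it
   as soon as [t] generates the kernel of the residue map (see [vge_loc]). *)
Inductive locring : K -> Prop :=
| loc_const c : locring (emb c)
| loc_t : locring t
| loc_u : locring u
| loc_add f f' : locring f -> locring f' -> locring (f + f')
| loc_mul f f' : locring f -> locring f' -> locring (f * f')
| loc_inv f : locring f -> f != 0 -> P f = 0 -> locring f^-1.

Definition locfrac f := exists a b, [/\ locring a, locring b, b != 0 & f = a / b].

Lemma loc1 : locring 1.
Proof. by rewrite -(rmorph1 emb); constructor. Qed.

Lemma loc_opp f : locring f -> locring (- f).
Proof.
by move=> h; rewrite -mulN1r -(rmorph1 emb) -rmorphN; apply: loc_mul; first constructor.
Qed.

Lemma loc_exp f i : locring f -> locring (f ^+ i).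
Proof.
move=> h; elim: i => [|i IH]; [exact: loc1 | by rewrite exprS; apply: loc_mul].
Qed.

Lemma loc_horner z (r : {poly k}) : locring z -> locring (map_poly emb r).[z].
Proof.
move=> hz; elim/poly_ind: r => [|r c IH].
  by rewrite rmorph0 horner0 -(rmorph0 emb); constructor.
rewrite rmorphD rmorphM /= map_polyX map_polyC /= !hornerE.
by apply: loc_add; [apply: loc_mul | constructor].
Qed.

Lemma locfrac_loc f : locring f -> locfrac f.
Proof. by move=> h; exists f, 1; rewrite divr1 oner_eq0; split=> //; exact: loc1. Qed.

Lemma locfracD f f' : locfrac f -> locfrac f' -> locfrac (f + f').
Proof.
move=> [a [b [ha hb b0 ->]]] [a' [b' [ha' hb' b'0 ->]]].
exists (a * b' + a' * b), (b * b'); split.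
- by apply: loc_add; apply: loc_mul.
- exact: loc_mul.
- by rewrite mulf_neq0.
- by rewrite addf_div.
Qed.

Lemma locfracM f f' : locfrac f -> locfrac f' -> locfrac (f * f').
Proof.
move=> [a [b [ha hb b0 ->]]] [a' [b' [ha' hb' b'0 ->]]].
exists (a * a'), (b * b'); split; try exact: loc_mul.
- by rewrite mulf_neq0.
- by rewrite mulf_div.
Qed.

Lemma locfracV f : locfrac f -> locfrac f^-1.
Proof.
move=> [a [b [ha hb b0 ->]]]; have [->|a0] := eqVneq a 0.
  by rewrite mul0r invr0; apply: locfrac_loc; rewrite -(rmorph0 emb); constructor.
by exists b, a; rewrite invf_div.
Qed.

Variable c : k.
Hypotheses (t0 : t != 0) (Pt : 0 < P t) (Pu : vge P 1 (u - emb c))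
  (ut_loc : locring ((u - emb c) / t)) (all_frac : forall f, locfrac f).

Lemma loc_vge f : locring f -> vge P 0 f.
Proof.
elim=> [a||| f1 f2 _ h1 _ h2|f1 f2 _ h1 _ h2|f1 _ _ f10 Pf1].
- exact: vge_const.
- by rewrite vgeE // ltW.
- by rewrite -[u](subrK (emb c)) vgeD ?vge_const // (vgeW _ Pu).
- exact: vgeD.
- by rewrite -[0]addr0 vgeM.
- by rewrite vgeE ?invr_eq0 // ordV // Pf1.
Qed.

(** Congruence to a constant modulo [t] is checked on the generators. For [u] it is [ut_loc]; for an
    inverse, with [f1 = a1 + t g1], one has [1 / f1 - 1 / a1 = - t g1 / (a1 f1)]. *)
Lemma loc_residue f : locring f -> exists a g, locring g /\ f = emb a + t * g.
Proof.
have loc0 : locring 0 by rewrite -(rmorph0 emb); constructor.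
elim=> [a||| f1 f2 _ [a1 [g1 [h1 e1]]] _ [a2 [g2 [h2 e2]]]
  |f1 f2 _ [a1 [g1 [h1 e1]]] l2 [a2 [g2 [h2 e2]]]|f1 l1 [a1 [g1 [h1 e1]]] f10 Pf1].
- by exists a, 0; rewrite mulr0 addr0.
- by exists 0, 1; rewrite rmorph0 add0r mulr1; split=> //; exact: loc1.
- exists c, ((u - emb c) / t); split=> //.
  by rewrite mulrCA divff // mulr1 addrC subrK.
- exists (a1 + a2), (g1 + g2); split; first exact: loc_add.
  by rewrite e1 e2 rmorphD; ring.
- exists (a1 * a2), (emb a1 * g2 + g1 * f2); split.
    by apply: loc_add; apply: loc_mul => //; constructor.
  by rewrite e1 e2 rmorphM; ring.
- have a10 : a1 != 0.
    apply/eqP => a10; have := loc_vge h1.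
    have g10 : g1 != 0 by apply: contra_neq f10 => g10; rewrite e1 a10 g10 rmorph0 mulr0 addr0.
    by rewrite vgeE //; move: Pf1; rewrite e1 a10 rmorph0 add0r ordM //; lia.
  have ea10 : emb a1 != 0 by rewrite fmorph_eq0.
  exists a1^-1, (- g1 * (emb a1^-1 * f1^-1)); split.
    by apply: loc_mul; [exact: loc_opp | apply: loc_mul; constructor].
  rewrite fmorphV; have -> : g1 = (f1 - emb a1) / t.
    by rewrite e1 addrC addKr mulrC mulKf.
  by field; rewrite f10 ea10 t0.
Qed.

(** An element of positive order has residue zero, hence is [t] times an element of the ring of
    smaller order; induction on the order. *)
Lemma loc_factor f : locring f -> f != 0 ->
  exists i v, [/\ locring v, v != 0, P v = 0 & f = t ^+ i * v].
Proof.
move=> lf f0; have := loc_vge lf; rewrite vgeE //.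
have [N] := ubnP `|P f|%N; elim: N f lf f0 => // N IH f lf f0 ltN Pf.
have [Pf0|Pf0] := eqVneq (P f) 0; first by exists 0%N, f; rewrite expr0 mul1r.
have [a [g [lg e]]] := loc_residue lf.
have tg : vge P 1 (t * g) by rewrite -[1]addr0 vgeM ?loc_vge // vgeE //; lia.
have a0 : a = 0.
  apply/eqP; apply: contraT => a0.
  have [] := @ord_unit_of_residue _ _ _ P f a a0; last by move=> _ /eqP; rewrite (negPf Pf0).
  by rewrite e addrC addKr.
move: e; rewrite a0 rmorph0 add0r => e.
have g0 : g != 0 by apply: contra_neq f0 => g0; rewrite e g0 mulr0.
have Pe : P f = P t + P g by rewrite e ordM.
have Pg : 0 <= P g by rewrite -vgeE // loc_vge.
have [|i [v [lv v0 Pv eg]]] := IH g lg g0 _ Pg; first by lia.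
by exists i.+1, v; split=> //; rewrite e eg exprS mulrA.
Qed.

Lemma loc_field_factor f : f != 0 ->
  exists v i j, [/\ locring v, v != 0, P v = 0 & f * t ^+ j = t ^+ i * v].
Proof.
have [a [b [la lb b0 ->]]] := all_frac f; rewrite mulf_eq0 invr_eq0 negb_or b0 andbT => a0.
have [i [v [lv v0 Pv ->]]] := loc_factor la a0.
have [j [w [lw w0 Pw ->]]] := loc_factor lb b0.
exists (v / w), i, j; split.
- by apply: loc_mul => //; apply: loc_inv.
- by rewrite mulf_neq0 ?invr_eq0.
- by rewrite ord_div // Pv Pw.
- by field; rewrite w0 expf_neq0.
Qed.

(** By the factorization every order is a multiple of [P t], and some element has order 1. *)
Lemma loc_uniformizer : P t = 1.
Proof.
have [s s0 Ps] := ord_uniformizer P.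
have [v [i [j [_ v0 Pv e]]]] := loc_field_factor s0.
have : P (s * t ^+ j) = P (t ^+ i * v) by rewrite e.
rewrite !ordM ?expf_neq0 // !ordX // Ps Pv -[P t *+ j]mulr_natr -[P t *+ i]mulr_natr => e1.
have e2 : (i%:R - j%:R) * P t = 1 by rewrite mulrBl; lia.
have : (P t %| 1)%Z by apply/dvdzP; exists (i%:R - j%:R); rewrite e2.
by rewrite dvdz1; lia.
Qed.

(** In [f * t ^ j = t ^ i * v] with [v] a unit of the ring, a nonnegative order of [f] means
    [j <= i], so [f] is a power of [t] times [v]. *)
Lemma vge_loc f : vge P 0 f -> locring f.
Proof.
have [->|f0] := eqVneq f 0; first by move=> _; rewrite -(rmorph0 emb); constructor.
rewrite vgeE //; have [v [i [j [lv v0 Pv e]]]] := loc_field_factor f0.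
have : P (f * t ^+ j) = P (t ^+ i * v) by rewrite e.
rewrite !ordM ?expf_neq0 // !ordX // loc_uniformizer Pv => eP fP.
have le_ji : (j <= i)%N by move: eP; lia.
have -> : f = t ^+ (i - j) * v.
  apply: (mulIf (expf_neq0 j t0)); rewrite e.
  by rewrite mulrAC -exprD subnK.
by apply: loc_mul => //; apply: loc_exp; constructor.
Qed.

Variable D : K -> K.
Hypotheses (Dadd : forall f f', D (f + f') = D f + D f')
  (Dmul : forall f f', D (f * f') = f * D f' + f' * D f)
  (Dconst : forall c, D (emb c) = 0)
  (Dt0 : D t != 0) (Du_loc : locring (D u / D t)).

(** [D / D t] is differentiation with respect to [t]; once it sends [u] into the ring, the Leibniz
    and quotient rules carry this to all elements. *)
Lemma loc_derive f : locring f -> locring (D f / D t).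
Proof.
have loc0 : locring 0 by rewrite -(rmorph0 emb); constructor.
elim=> [a||| f1 f2 _ h1 _ h2|f1 f2 l1 h1 l2 h2|f1 l1 h1 f10 Pf1].
- by rewrite Dconst mul0r.
- by rewrite divff //; exact: loc1.
- by [].
- by rewrite Dadd mulrDl; apply: loc_add.
- by rewrite Dmul mulrDl -!mulrA; apply: loc_add; apply: loc_mul.
- have -> : D f1^-1 / D t = - (D f1 / D t) * (f1^-1 * f1^-1).
    have : D (f1 * f1^-1) = 0 by rewrite divff // -(rmorph1 emb) Dconst.
    rewrite Dmul => /eqP; rewrite addr_eq0 => /eqP e.
    by apply: (mulfI f10); rewrite mulrA e; field; rewrite f10.
  apply: loc_mul; first exact: loc_opp.
  by apply: loc_mul; apply: loc_inv.
Qed.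

Lemma vge_derive f : vge P 0 f -> vge P (P (D t)) (D f).
Proof.
move=> /vge_loc /loc_derive /loc_vge h.
rewrite -[D f](divfK Dt0) -[P (D t)]add0r vgeM // vgeE //.
Qed.

End LocalRing.

(** * New points from old ones *)

HB.instance Definition _ (k K : fieldType) (emb : {rmorphism k -> K}) (x y : K) :=
  GRing.RMorphism.copy (evalXY emb x y)
    (horner_eval x \o (horner_eval y%:P \o map_poly (map_poly emb))).

Section EvalXY.
Variables (k K : fieldType) (emb : {rmorphism k -> K}) (x y : K).

Lemma evalXY_C r : evalXY emb x y r%:P = (map_poly emb r).[x].
Proof. by rewrite /evalXY map_polyC hornerC. Qed.

Lemma evalXY_X : evalXY emb x y 'X = y.
Proof. by rewrite /evalXY map_polyX hornerX hornerC. Qed.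

Lemma evalXYB (p q : {poly {poly k}}) :
  evalXY emb x y (p - q) = evalXY emb x y p - evalXY emb x y q.
Proof. by rewrite rmorphB. Qed.

Lemma evalXY_model n (h : {poly k}) :
  evalXY emb x y ('X^n - h%:P) = y ^+ n - (map_poly emb h).[x].
Proof. by rewrite evalXYB rmorphXn /= evalXY_X evalXY_C. Qed.

Lemma evalXY_sum (p : {poly {poly k}}) N : (size p <= N)%N ->
  evalXY emb x y p = \sum_(i < N) (map_poly emb p`_i).[x] * y ^+ i.
Proof.
move=> sp; have {1}-> : p = \sum_(i < N) (p`_i)%:P * 'X^i.
  rewrite -{1}(take_poly_id sp) /take_poly poly_def.
  by apply: eq_bigr => i _; rewrite mul_polyC.
rewrite rmorph_sum; apply: eq_bigr => i _.
by rewrite rmorphM rmorphXn /= evalXY_C evalXY_X.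
Qed.

End EvalXY.

(** * Cauchy sequences for the valuation [P], in place of elements of the completion *)

Section Sequences.
Variables (k K : fieldType) (emb : {rmorphism k -> K}) (P : point emb).

Definition null_seq (a : nat -> K) :=
  forall M, exists N0, forall N, (N0 <= N)%N -> vge P M (a N).

Definition cauchy_seq (a : nat -> K) :=
  forall M, exists N0, forall N, (N0 <= N)%N -> vge P M (a N - a N0).

Lemma cauchy_const f : cauchy_seq (fun=> f).
Proof. by move=> M; exists 0%N => N _; rewrite subrr vge0r. Qed.

Lemma cauchy_bounded a : cauchy_seq a ->
  exists M N0, forall N, (N0 <= N)%N -> vge P M (a N).
Proof.
move=> /(_ 0)[N0 h]; have [e|e] := eqVneq (a N0) 0.
  by exists 0, N0 => N /h; rewrite e subr0.
exists (Num.min 0 (P (a N0))), N0 => N /h hN; rewrite -[a N](subrK (a N0)) vgeD //.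
  by apply: vgeW hN; rewrite ge_min lexx.
by rewrite vgeE // ge_min lexx orbT.
Qed.

Lemma cauchy_shift a M : cauchy_seq a -> exists N0, forall N N',
  (N0 <= N)%N -> (N0 <= N')%N -> vge P M (a N - a N').
Proof.
move=> /(_ M)[N0 h]; exists N0 => N N' /h hN /h hN'.
have -> : a N - a N' = (a N - a N0) - (a N' - a N0) by ring.
exact: vgeB.
Qed.

Lemma cauchyD a b : cauchy_seq a -> cauchy_seq b -> cauchy_seq (fun N => a N + b N).
Proof.
move=> ha hb M; have [N1 h1] := cauchy_shift M ha; have [N2 h2] := cauchy_shift M hb.
exists (maxn N1 N2) => N hN.
have -> : a N + b N - (a (maxn N1 N2) + b (maxn N1 N2)) =
  (a N - a (maxn N1 N2)) + (b N - b (maxn N1 N2)) by ring.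
by rewrite vgeD ?h1 ?h2 //; lia.
Qed.

Lemma cauchyM a b : cauchy_seq a -> cauchy_seq b -> cauchy_seq (fun N => a N * b N).
Proof.
move=> ha hb M.
have [A [N1 h1]] := cauchy_bounded ha; have [B [N2 h2]] := cauchy_bounded hb.
have [N3 h3] := cauchy_shift (M - B) ha; have [N4 h4] := cauchy_shift (M - A) hb.
exists (N1 + N2 + N3 + N4)%N => N hN; set N0 := (_ + _)%N in hN *.
have -> : a N * b N - a N0 * b N0 = (a N - a N0) * b N + a N0 * (b N - b N0) by ring.
apply: vgeD.
  by rewrite -[M](subrK B) vgeM ?h3 ?h2 //; lia.
by rewrite -[M](subrK A) addrC vgeM ?h4 ?h1 //; lia.
Qed.

Lemma cauchy_evalXY X Y p : cauchy_seq Y -> cauchy_seq (fun N => evalXY emb X (Y N) p).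
Proof.
move=> hY; elim/poly_ind: p => [|p r IH].
  by move=> M; exists 0%N => N _; rewrite !rmorph0 subrr vge0r.
have := cauchyD (cauchyM IH hY) (cauchy_const (map_poly emb r).[X]).
move=> h M; have [N0 hN0] := h M; exists N0 => N /hN0.
by rewrite !rmorphD !rmorphM /= !evalXY_C !evalXY_X.
Qed.

Lemma null_mul a b : null_seq a -> cauchy_seq b -> null_seq (fun N => a N * b N).
Proof.
move=> ha /cauchy_bounded[B [N2 h2]] M; have [N1 h1] := ha (M - B).
by exists (N1 + N2)%N => N hN; rewrite -[M](subrK B) vgeM ?h1 ?h2 //; lia.
Qed.

Lemma nullB a b : null_seq a -> null_seq b -> null_seq (fun N => a N - b N).
Proof.
move=> ha hb M; have [N1 h1] := ha M; have [N2 h2] := hb M.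
by exists (N1 + N2)%N => N hN; rewrite vgeB ?h1 ?h2 //; lia.
Qed.

Lemma null_constN f : f != 0 -> ~ null_seq (fun=> f).
Proof.
by move=> f0 /(_ (P f + 1))[N0 /(_ N0 (leqnn _))]; rewrite vgeE //; lia.
Qed.

(** The order of the limit in the completion, expressed without forming the limit. *)
Definition lim_ord (a : nat -> K) (e : int) :=
  exists N0, forall N, (N0 <= N)%N -> a N != 0 /\ P (a N) = e.

Lemma lim_ord_uniq a e e' : lim_ord a e -> lim_ord a e' -> e = e'.
Proof.
move=> [N1 h1] [N2 h2]; have [_ <-] := h1 (N1 + N2)%N ltac:(lia).
by have [_ <-] := h2 (N1 + N2)%N ltac:(lia).
Qed.

Lemma lim_ordM a b e e' : lim_ord a e -> lim_ord b e' ->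
  lim_ord (fun N => a N * b N) (e + e').
Proof.
move=> [N1 h1] [N2 h2]; exists (N1 + N2)%N => N hN.
have [a0 <-] := h1 N ltac:(lia); have [b0 <-] := h2 N ltac:(lia).
by rewrite mulf_neq0 // ordM.
Qed.

Lemma lim_ordD a b c e e' e'' : lim_ord a e -> lim_ord b e' -> lim_ord c e'' ->
  (exists N0, forall N, (N0 <= N)%N -> a N + b N = c N) -> Num.min e e' <= e''.
Proof.
move=> [N1 h1] [N2 h2] [N3 h3] [N4 h4]; set N := (N1 + N2 + N3 + N4)%N.
have [a0 <-] := h1 N ltac:(rewrite /N; lia).
have [b0 <-] := h2 N ltac:(rewrite /N; lia).
have [c0 <-] := h3 N ltac:(rewrite /N; lia).
have e4 : a N + b N = c N by apply: h4; rewrite /N; lia.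
by rewrite -e4 ordD // e4.
Qed.

Lemma lim_ord_ext a b e : (exists N0, forall N, (N0 <= N)%N -> a N = b N) ->
  lim_ord a e -> lim_ord b e.
Proof.
move=> [N1 h1] [N2 h2]; exists (N1 + N2)%N => N hN.
by rewrite -(h1 N ltac:(lia)); apply: h2; lia.
Qed.

Lemma lim_ord_null a b e : null_seq (fun N => a N - b N) -> lim_ord a e -> lim_ord b e.
Proof.
move=> /(_ (e + 1))[N1 h1] [N2 h2]; exists (N1 + N2)%N => N hN.
have [a0 Pa] := h2 N ltac:(lia).
rewrite -[b N](subKr (a N)) -Pa; apply: ordDl => //.
by rewrite vgeN Pa h1 //; lia.
Qed.

(** Beyond [N0] the terms differ by order at least [M], while some term has order below [M]; hence
    all these terms have the order of that one. *)
Lemma cauchy_lim_ord a : cauchy_seq a -> ~ null_seq a -> exists e, lim_ord a e.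
Proof.
move=> ha /not_all_ex_not[M hM]; have [N0 h0] := cauchy_shift M ha.
have [N1 N01 h1] : exists2 N1, (N0 <= N1)%N & ~~ vge P M (a N1).
  apply: NNPP => h; apply: hM; exists N0 => N hN; apply: contraT => hn.
  by case: h; exists N.
have aN1 : a N1 != 0 by apply: contraNneq h1 => ->; rewrite vge0r.
exists (P (a N1)), N0 => N hN; rewrite -[a N](subrK (a N1)) addrC.
apply: ordDl => //; apply: vgeW (h0 _ _ hN N01); move: h1; rewrite vgeE //; lia.
Qed.

End Sequences.

(** * Polynomials in [y] over [k[x]]: independence, norms and common denominators *)

Section FunctionField.
Variables (k K : fieldType) (emb : {rmorphism k -> K}) (x y : K).
Variables (n : nat) (h : {poly k}).
Hypotheses (n_gt0 : (0 < n)%N) (modelK : function_field_of emb x y n h).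

Lemma model_monic : ('X^n - h%:P : {poly {poly k}}) \is monic.
Proof. by rewrite monicXnsubC. Qed.

Lemma model_y : y ^+ n = (map_poly emb h).[x].
Proof.
have /modelK.1 : exists q : {poly {poly k}}, 'X^n - h%:P = q * ('X^n - h%:P).
  by exists 1; rewrite mul1r.
by rewrite evalXY_model => /eqP; rewrite subr_eq0 => /eqP.
Qed.

(** A nonzero multiple of the monic polynomial [Y ^ n - h] has degree at least [n] in [Y]; thus 1,
    y, ..., y^(n-1) are independent over [k[x]]. *)
Lemma evalXY_small (p : {poly {poly k}}) : (size p <= n)%N -> evalXY emb x y p = 0 -> p = 0.
Proof.
move=> sp /modelK.1[q e]; have [q0|q0] := eqVneq q 0; first by rewrite e q0 mul0r.
move: sp; rewrite e size_Mmonic ?model_monic // size_XnsubC //.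
by rewrite addnS -[leqRHS]add0n leq_add2r leqn0 size_poly_eq0 (negPf q0).
Qed.

Lemma model_transc r : r != 0 -> (map_poly emb r).[x] != 0.
Proof.
move=> r0; apply: contra_neq r0 => e; apply/eqP; rewrite -polyC_eq0; apply/eqP.
by apply: evalXY_small; [exact: leq_trans (size_polyC_leq1 _) n_gt0 | rewrite evalXY_C].
Qed.

Let evx : {rmorphism {poly k} -> K} := horner_eval x \o map_poly emb.

Lemma evalXY_horner p : evalXY emb x y p = (map_poly evx p).[y].
Proof.
elim/poly_ind: p => [|p r IH]; first by rewrite !rmorph0 horner0.
by rewrite !rmorphD !rmorphM /= IH evalXY_C evalXY_X map_polyX map_polyC !hornerE.
Qed.

Lemma evalXY_integral p : integralOver evx (evalXY emb x y p).
Proof.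
rewrite evalXY_horner; apply: integral_horner.
  by apply/integral_poly => i; rewrite coef_map; exact: integral_id.
exists ('X^n - h%:P); first exact: model_monic.
by rewrite rootE rmorphB rmorphXn /= map_polyX map_polyC !hornerE model_y subrr.
Qed.

Lemma evalXY_comp p (q : {poly {poly k}}) :
  exists s, evalXY emb x y s = (map_poly evx q).[evalXY emb x y p].
Proof.
elim/poly_ind: q => [|q r [s IH]]; first by exists 0; rewrite !rmorph0 horner0.
exists (s * p + r%:P).
by rewrite !rmorphD !rmorphM /= IH evalXY_C map_polyX map_polyC !hornerE.
Qed.

(* Constant term of an equation of integral dependence over [k[x]]. *)
Lemma evalXY_norm p : evalXY emb x y p != 0 ->
  exists s r, r != 0 /\ evalXY emb x y (p * s) = (map_poly emb r).[x].
Proof.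
move=> p0; have [q q_mon /eqP] := evalXY_integral p.
(* Powers of the variable are split off the integral equation first, so that the remaining constant
   term [q'.[0]] is nonzero. *)
have [i [q' q'0 ->]] := multiplicity_XsubC q 0; rewrite polyC0 subr0.
rewrite monic_neq0 //= in q'0.
rewrite rmorphM rmorphXn /= map_polyX hornerM horner_exp hornerX.
move/eqP; rewrite mulf_eq0 expf_eq0 (negPf p0) andbF orbF => /eqP.
have /factor_theorem[q''] : root (q' - q'.[0]%:P) 0 by rewrite rootE !hornerE subrr.
rewrite polyC0 subr0 => /(canRL (subrK _)) {1}->.
rewrite rmorphD rmorphM /= map_polyX map_polyC /= hornerD hornerM hornerX hornerC.
(* The equation now reads [p q''(p) + q'(0) = 0], so the cofactor wanted is [- q''(p)]. *)
move=> e0; have [s es] := evalXY_comp p q''.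
exists (- s), q'.[0]; split; first by rewrite -rootE.
rewrite rmorphM rmorphN /= es mulrN mulrC; apply/eqP.
by rewrite eq_sym -subr_eq0 opprK addrC e0.
Qed.

Lemma evalXY_reduce (p : {poly {poly k}}) :
  exists2 G : {poly {poly k}}, (size G <= n)%N & evalXY emb x y G = evalXY emb x y p.
Proof.
have hm := model_monic; exists (Pdiv.Ring.rmodp p ('X^n - h%:P)).
  by rewrite -ltnS -(size_XnsubC h n_gt0) Pdiv.Ring.ltn_rmodpN0 // monic_neq0.
have {2}-> := Pdiv.RingMonic.rdivp_eq hm p.
by rewrite rmorphD rmorphM /= evalXY_model model_y subrr mulr0 add0r.
Qed.

(** Multiplying numerator and denominator by the cofactor from [evalXY_norm] turns the denominator
    into a polynomial in [x] alone. *)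
Lemma normal_form f : exists (D : {poly k}) (G : {poly {poly k}}),
  [/\ D != 0, (size G <= n)%N & f * (map_poly emb D).[x] = evalXY emb x y G].
Proof.
have [p [q [q0 ->]]] := modelK.2 f.
have [s [r [r0 e]]] := evalXY_norm q0; have [G sG eG] := evalXY_reduce (p * s).
by exists r, G; split=> //; rewrite eG -e !rmorphM /= mulrA divfK.
Qed.

(** * The point obtained by sending [x] to [X] and [y] to the limit of [Y] *)

Section NewPoint.
Variables (P : point emb) (X : K) (Y : nat -> K) (eY : int) (b : k) (i j : nat).
Hypotheses (h_neq0 : h != 0)
  (X_transc : forall r, r != 0 -> (map_poly emb r).[X] != 0)
  (Y_cauchy : cauchy_seq P Y)
  (Y_root : null_seq P (fun N => Y N ^+ n - (map_poly emb h).[X]))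
  (Y_neq0 : forall N, Y N != 0) (Y_ord : forall N, P (Y N) = eY)
  (bezout : P (X - emb b) *+ i - eY *+ j = 1).

Let spec p N := evalXY emb X (Y N) p.

Lemma spec_null p : evalXY emb x y p = 0 -> null_seq P (spec p).
Proof.
move=> /modelK.1[q ->] M.
have [N0 hN0] := null_mul Y_root (cauchy_evalXY X q Y_cauchy) M.
exists N0 => N /hN0; rewrite /spec rmorphM /=.
by rewrite evalXY_model mulrC.
Qed.

(** Some multiple of [p] equals a nonzero [r(x)]. If [p(X, Y_N)] tended to zero, so would the
    constant sequence [r(X)], which is nonzero because [X] is transcendental. *)
Lemma spec_lim p : evalXY emb x y p != 0 -> exists e, lim_ord P (spec p) e.
Proof.
move=> p0; apply: cauchy_lim_ord; first exact: cauchy_evalXY.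
move=> null_p; have [s [r [r0 e]]] := evalXY_norm p0.
have /spec_null h1 : evalXY emb x y (p * s - r%:P) = 0.
  by rewrite evalXYB e evalXY_C subrr.
have h2 := null_mul null_p (cauchy_evalXY X s Y_cauchy).
apply: (@null_constN _ _ _ P _ (X_transc r0)) => M.
have [N0 hN0] := nullB h2 h1 M; exists N0 => N /hN0.
by rewrite /spec evalXYB rmorphM /= evalXY_C subKr.
Qed.

Lemma spec_lim_eq p p' e : evalXY emb x y p = evalXY emb x y p' ->
  lim_ord P (spec p) e -> lim_ord P (spec p') e.
Proof.
move=> epp'; apply: lim_ord_null.
have /spec_null hn : evalXY emb x y (p - p') = 0 by rewrite evalXYB epp' subrr.
by move=> M; have [N0 hN0] := hn M; exists N0 => N /hN0; rewrite /spec evalXYB.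
Qed.

Lemma spec_limM p p' e e' : lim_ord P (spec p) e -> lim_ord P (spec p') e' ->
  lim_ord P (spec (p * p')) (e + e').
Proof.
move=> h1 h2; apply: lim_ord_ext (lim_ordM h1 h2).
by exists 0%N => N _; rewrite /spec rmorphM.
Qed.

(** The order is first a relation, ranging over all ways to write [f] as a fraction; independence of
    the fraction is proved before a value is chosen. *)
Definition new_ord_rel f e := exists p q e1 e2, [/\ evalXY emb x y q != 0,
  f * evalXY emb x y q = evalXY emb x y p,
  lim_ord P (spec p) e1, lim_ord P (spec q) e2 & e = e1 - e2].

Lemma new_ord_ex f : f != 0 -> exists e, new_ord_rel f e.
Proof.
move=> f0; have [p [q [q0 ef]]] := modelK.2 f.
have p0 : evalXY emb x y p != 0 by move: f0; rewrite ef mulf_eq0 negb_or => /andP[].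
have [e1 h1] := spec_lim p0; have [e2 h2] := spec_lim q0.
by exists (e1 - e2), p, q, e1, e2; split=> //; rewrite ef divfK.
Qed.

Lemma new_ord_uniq f e e' : new_ord_rel f e -> new_ord_rel f e' -> e = e'.
Proof.
move=> [p [q [e1 [e2 [q0 ef h1 h2 ->]]]]] [p' [q' [e1' [e2' [q'0 ef' h1' h2' ->]]]]].
have epq : evalXY emb x y (p * q') = evalXY emb x y (p' * q).
  by rewrite !rmorphM /= -ef -ef'; ring.
have := lim_ord_uniq (spec_lim_eq epq (spec_limM h1 h2')) (spec_limM h1' h2).
lia.
Qed.

(** The implication lets the choice of a value also cover [f = 0], where it is arbitrary. *)
Lemma new_ord_total f : exists e, f != 0 -> new_ord_rel f e.
Proof.
have [->|f0] := eqVneq f 0; first by exists 0.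
by have [e he] := new_ord_ex f0; exists e.
Qed.

Definition new_ord f : int := sval (constructive_indefinite_description _ (new_ord_total f)).

Lemma new_ordP f e : f != 0 -> new_ord_rel f e -> new_ord f = e.
Proof.
move=> f0 he; apply: new_ord_uniq he.
by rewrite /new_ord; case: constructive_indefinite_description => e' /=; apply.
Qed.

Lemma new_ord_relM f f' e e' : new_ord_rel f e -> new_ord_rel f' e' ->
  new_ord_rel (f * f') (e + e').
Proof.
move=> [p [q [e1 [e2 [q0 ef h1 h2 ->]]]]] [p' [q' [e1' [e2' [q'0 ef' h1' h2' ->]]]]].
exists (p * p'), (q * q'), (e1 + e1'), (e2 + e2'); split; try exact: spec_limM.
- by rewrite rmorphM mulf_neq0.
- by rewrite !rmorphM /= -ef -ef'; ring.
- by lia.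
Qed.

Lemma new_ord_evalXY p e : evalXY emb x y p != 0 -> lim_ord P (spec p) e ->
  new_ord_rel (evalXY emb x y p) e.
Proof.
move=> p0 hp; exists p, 1, e, 0; split=> //; rewrite ?rmorph1 ?oner_eq0 ?mulr1 ?subr0 //.
by exists 0%N => N _; rewrite /spec rmorph1 oner_eq0 ord_one.
Qed.

Fact new_ordM f f' : f != 0 -> f' != 0 -> new_ord (f * f') = new_ord f + new_ord f'.
Proof.
move=> f0 f'0; have [e he] := new_ord_ex f0; have [e' he'] := new_ord_ex f'0.
rewrite (new_ordP f0 he) (new_ordP f'0 he') (@new_ordP _ (e + e')) ?mulf_neq0 //.
exact: new_ord_relM.
Qed.

Fact new_ordD f f' : f != 0 -> f' != 0 -> f + f' != 0 ->
  Num.min (new_ord f) (new_ord f') <= new_ord (f + f').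
Proof.
move=> f0 f'0 ff0; have [e he] := new_ord_ex f0; have [e' he'] := new_ord_ex f'0.
rewrite (new_ordP f0 he) (new_ordP f'0 he').
case: he => p [q [e1 [e2 [q0 ef h1 h2 ->]]]].
case: he' => p' [q' [e1' [e2' [q'0 ef' h1' h2' ->]]]].
have qq0 : evalXY emb x y (q * q') != 0 by rewrite rmorphM mulf_neq0.
have eff : (f + f') * evalXY emb x y (q * q') = evalXY emb x y (p * q' + p' * q).
  by rewrite rmorphD !rmorphM /= -ef -ef'; ring.
have [|e3 h3] := @spec_lim (p * q' + p' * q); first by rewrite -eff mulf_neq0.
rewrite (@new_ordP _ (e3 - (e2 + e2'))) //; last first.
  by exists (p * q' + p' * q), (q * q'), e3, (e2 + e2'); split=> //; exact: spec_limM.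
have hs : exists N0, forall N, (N0 <= N)%N ->
    spec (p * q') N + spec (p' * q) N = spec (p * q' + p' * q) N.
  by exists 0%N => N _; rewrite /spec rmorphD.
have := lim_ordD (spec_limM h1 h2') (spec_limM h1' h2) h3 hs.
by rewrite !minEle; do 2 case: ifP; lia.
Qed.

Fact new_ord_const c : c != 0 -> new_ord (emb c) = 0.
Proof.
move=> c0; have e : emb c = evalXY emb x y c%:P%:P.
  by rewrite evalXY_C map_polyC hornerC.
apply: new_ordP; rewrite ?fmorph_eq0 // e; apply: new_ord_evalXY.
  by rewrite -e fmorph_eq0.
exists 0%N => N _; rewrite /spec evalXY_C map_polyC hornerC.
by rewrite fmorph_eq0 c0 ord_const.
Qed.

(** By [bezout] the function [(x - b) ^ i / y ^ j] has order 1, so the new valuation is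
    normalized. *)
Fact new_ord_uniformizer : exists2 t, t != 0 & new_ord t = 1.
Proof.
have xb0 : (map_poly emb ('X - b%:P)).[x] != 0 by rewrite model_transc ?polyXsubC_eq0.
have y0 : evalXY emb x y ('X ^+ j) != 0.
  rewrite rmorphXn /= evalXY_X expf_neq0 //; apply: contraNneq (model_transc h_neq0).
  by rewrite -model_y => ->; rewrite expr0n eqn0Ngt n_gt0.
have xb_lim : lim_ord P (spec (('X - b%:P) ^+ i)%:P) (P (X - emb b) *+ i).
  exists 0%N => N _; rewrite /spec evalXY_C rmorphXn /= map_polyXsubC horner_exp hornerXsubC.
  have Xb0 : X - emb b != 0.
    have := X_transc (negbT (polyXsubC_eq0 b)).
    by rewrite map_polyXsubC hornerXsubC.
  by rewrite expf_neq0 // ordX.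
have y_lim : lim_ord P (spec ('X ^+ j)) (eY *+ j).
  by exists 0%N => N _; rewrite /spec rmorphXn /= evalXY_X expf_neq0 // ordX // Y_ord.
have xbi0 : evalXY emb x y (('X - b%:P) ^+ i)%:P != 0.
  by rewrite evalXY_C rmorphXn horner_exp expf_neq0.
exists (evalXY emb x y (('X - b%:P) ^+ i)%:P / evalXY emb x y ('X ^+ j)).
  by rewrite mulf_neq0 ?invr_eq0.
apply: new_ordP; first by rewrite mulf_neq0 ?invr_eq0.
exists (('X - b%:P) ^+ i)%:P, ('X ^+ j), (P (X - emb b) *+ i), (eY *+ j).
by split=> //; rewrite divfK.
Qed.

Definition new_point : point emb :=
  Point new_ordM new_ordD new_ord_const new_ord_uniformizer.

Lemma new_pointE p e : evalXY emb x y p != 0 -> lim_ord P (spec p) e ->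
  new_point (evalXY emb x y p) = e.
Proof. by move=> p0 hp; apply: new_ordP => //; apply: new_ord_evalXY. Qed.

End NewPoint.
End FunctionField.

(** * Differentials *)

Section Derivations.
Variables (k K : fieldType) (emb : {rmorphism k -> K}) (M : lmodType K) (d : K -> M).
Hypothesis der : derivation emb d.

Let dD f f' : d (f + f') = d f + d f'. Proof. by case: der. Qed.
Let dM f f' : d (f * f') = f *: d f' + f' *: d f. Proof. by case: der. Qed.
Let dC c : d (emb c) = 0. Proof. by case: der. Qed.

Lemma derivationX f i : d (f ^+ i) = (i%:R * f ^+ i.-1) *: d f.
Proof.
elim: i => [|i IH]; first by rewrite expr0 -(rmorph1 emb) dC mul0r scale0r.
rewrite exprS dM IH scalerA -scalerDl; congr (_ *: _).
by case: i {IH} => [|i] /=; rewrite ?exprS; ring.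
Qed.

Lemma derivationV f : f != 0 -> d f^-1 = (- f ^- 2) *: d f.
Proof.
move=> f0; have : d (f * f^-1) = 0 by rewrite divff // -(rmorph1 emb) dC.
rewrite dM => /eqP; rewrite addr_eq0 => /eqP e.
apply: (scalerI f0); rewrite e scalerA -scaleNr; congr (_ *: _).
by rewrite mulrN expr2 invfM mulrA divff // mul1r.
Qed.

Lemma derivation_horner z r : d (map_poly emb r).[z] = (map_poly emb r^`()).[z] *: d z.
Proof.
elim/poly_ind: r => [|r c IH].
  by rewrite rmorph0 horner0 deriv0 rmorph0 horner0 -(rmorph0 emb) dC rmorph0 scale0r.
rewrite derivD derivM derivX derivC addr0 mulr1 !rmorphD !rmorphM /=.
rewrite map_polyX map_polyC /= !hornerE dD dM dC addr0 IH scalerA -scalerDl.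
by congr (_ *: _); ring.
Qed.

End Derivations.

(** * The Kaehler differentials of [k(x, y)]: a line spanned by [dx] *)

Section Differential.
Variables (k K : fieldType) (emb : {rmorphism k -> K}) (x y : K).
Variables (n : nat) (h : {poly k}).
Hypotheses (n_gt0 : (0 < n)%N) (modelK : function_field_of emb x y n h).
Hypotheses (h_neq0 : h != 0) (n_neq0 : n%:R != 0 :> k).
Variables (Omega : lmodType K) (d : K -> Omega).
Hypotheses (kaehler_d : kaehler emb d) (Omega_neq0 : exists w : Omega, w != 0).

Let der : derivation emb d. Proof. exact: kaehler_d.1. Qed.
Let dD f f' : d (f + f') = d f + d f'. Proof. by case: der. Qed.
Let dM f f' : d (f * f') = f *: d f' + f' *: d f. Proof. by case: der. Qed.
Let dC c : d (emb c) = 0. Proof. by case: der. Qed.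

Lemma model_y_neq0 : y != 0.
Proof.
apply: contraNneq (model_transc n_gt0 modelK h_neq0) => y0.
by rewrite -(model_y modelK) y0 expr0n eqn0Ngt n_gt0.
Qed.

Lemma emb_n_neq0 : n%:R != 0 :> K.
Proof. by rewrite -(rmorph_nat emb) fmorph_eq0. Qed.

Lemma model_dy : d y = ((map_poly emb h^`()).[x] / (n%:R * y ^+ n.-1)) *: d x.
Proof.
have c0 : n%:R * y ^+ n.-1 != 0 by rewrite mulf_neq0 ?emb_n_neq0 // expf_neq0 // model_y_neq0.
apply: (scalerI c0); rewrite -(derivationX der) (model_y modelK) (derivation_horner der).
by rewrite scalerA mulrC divfK.
Qed.

(** Differentiating [y ^ n = h(x)] makes [dy] a multiple of [dx]; the rules for sums, products and
    inverses do the rest. *)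
Lemma differential_dx f : exists g, d f = g *: d x.
Proof.
have polXY p : exists g, d (evalXY emb x y p) = g *: d x.
  elim/poly_ind: p => [|p r [g IH]].
    by exists 0; rewrite rmorph0 -(rmorph0 emb) dC rmorph0 scale0r.
  rewrite rmorphD rmorphM /= evalXY_X evalXY_C dD dM (derivation_horner der) IH model_dy.
  by rewrite !scalerA -!scalerDl; eexists.
have [p [q [q0 ->]]] := modelK.2 f; have [g e] := polXY p; have [g' e'] := polXY q.
by rewrite dM (derivationV der) // e e' !scalerA -scalerDl; eexists.
Qed.

(** The uniqueness half of the universal property, applied to [d] itself. *)
Lemma kaehler_id (phi : {linear Omega -> Omega}) :
  (forall f, phi (d f) = d f) -> phi =1 id.
Proof.
move=> h1 w; have [psi [_ h2]] := kaehler_d.2 _ _ der.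
by rewrite (h2 _ h1) -(h2 idfun).
Qed.

(** If [dx] were zero then [d] would be zero, and the zero map would fix every [d f]; it would be
    the identity, so [Omega] would vanish. *)
Lemma dx_neq0 : d x != 0.
Proof.
apply/eqP => dx0; have [w /eqP[]] := Omega_neq0.
rewrite -[w](@kaehler_id \0) // => f; have [g ->] := differential_dx f.
by rewrite dx0 scaler0.
Qed.

Definition derx f : K := sval (constructive_indefinite_description _ (differential_dx f)).

Lemma derxE f : d f = derx f *: d x.
Proof. by rewrite /derx; case: constructive_indefinite_description. Qed.

Lemma derx_unique f g : d f = g *: d x -> derx f = g.
Proof.
rewrite derxE => /eqP; rewrite -subr_eq0 -scalerBl scaler_eq0 (negPf dx_neq0) orbF.
by rewrite subr_eq0 => /eqP.
Qed.

Lemma derxD f f' : derx (f + f') = derx f + derx f'.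
Proof. by apply: derx_unique; rewrite dD scalerDl -!derxE. Qed.

Lemma derxM f f' : derx (f * f') = f * derx f' + f' * derx f.
Proof. by apply: derx_unique; rewrite dM scalerDl -!scalerA -!derxE. Qed.

Lemma derxC c : derx (emb c) = 0.
Proof. by apply: derx_unique; rewrite dC scale0r. Qed.

Lemma derx_x : derx x = 1.
Proof. by apply: derx_unique; rewrite scale1r. Qed.

Lemma derx_y : derx y = (map_poly emb h^`()).[x] / (n%:R * y ^+ n.-1).
Proof. exact/derx_unique/model_dy. Qed.

Lemma derx_derivation : derivation emb (derx : K -> K^o).
Proof. by split; [exact: derxD | exact: derxM | exact: derxC]. Qed.

(** [derx] factors through a linear [phi]. The endomorphism [w |-> phi(w) dx] fixes every [d f],
    hence is the identity. *)
Lemma differential_span w : exists f, w = f *: d x.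
Proof.
have [phi [h1 _]] := kaehler_d.2 _ _ derx_derivation.
pose psi w := (phi w : K) *: d x.
have psi_lin : linear psi.
  by move=> a u v; rewrite /psi linearP scalerDl scalerA.
pose psiL : {linear Omega -> Omega} :=
  HB.pack psi (GRing.isLinear.Build K Omega Omega *:%R psi psi_lin).
exists (phi w); rewrite -{1}[w](@kaehler_id psiL) // => f.
by rewrite /= /psi h1 -derxE.
Qed.

(** [kappa] is the order of [dx] at [P]. *)
Definition locdiff (P : point emb) (kappa : int) :=
  forall f e, f != 0 -> diff_ord d P (f *: d x) e <-> P f + kappa = e.

(** Another parameter is [t' = v t] with [v] a unit, and [derx t' = v * derx t + t * derx v]. The
    second term has larger order by the hypothesis on [derx], so [t] and [t'] assign the same order
    to [f dx]. *)
Lemma locdiff_uniformizer (P : point emb) t : t != 0 -> P t = 1 -> derx t != 0 ->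
  (forall f, vge P 0 f -> vge P (P (derx t)) (derx f)) -> locdiff P (- P (derx t)).
Proof.
move=> t0 Pt Dt0 hD f e f0; split=> [[t' [f' [t'0 Pt' f'0 ew Pf']]]|<-]; last first.
  exists t, (f / derx t); rewrite ord_div // mulf_neq0 ?invr_eq0 //.
  by split=> //; rewrite (derxE t) scalerA divfK.
pose v := t' / t; have v0 : v != 0 by rewrite mulf_neq0 ?invr_eq0.
have Pv : P v = 0 by rewrite ord_div // Pt Pt' subrr.
have et' : t' = v * t by rewrite divfK.
have [Dt'0 PDt'] : derx t' != 0 /\ P (derx t') = P (derx t).
  have e1 : P (derx t) = P (v * derx t) by rewrite ordM // Pv add0r.
  rewrite et' derxM e1; apply: ordDl; first by rewrite mulf_neq0.
  by rewrite -e1 addrC vgeM ?hD // vgeE // ?Pt ?Pv.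
have : f = f' * derx t'.
  move: ew; rewrite (derxE t') scalerA => /eqP; rewrite -subr_eq0 -scalerBl.
  by rewrite scaler_eq0 (negPf dx_neq0) orbF subr_eq0 => /eqP.
by move=> ->; rewrite ordM // Pf' PDt'; lia.
Qed.

End Differential.

(** * Newton iteration for n-th roots, and sums over roots of unity *)

Section Newton.
Variables (k K : fieldType) (emb : {rmorphism k -> K}) (P : point emb).

Lemma vge_nat (i : nat) : vge P 0 i%:R.
Proof. by rewrite -(rmorph_nat emb) vge_const. Qed.

Lemma vge_taylor (n : nat) a delta M : 0 <= M -> vge P 0 a -> vge P M delta ->
  vge P (M + M) ((a + delta) ^+ n - a ^+ n - n%:R * a ^+ n.-1 * delta).
Proof.
move=> M0 ha hd; elim: n => [|n IH]; first by rewrite !expr0 subrr mul0r mul0r subr0 vge0r.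
have -> : (a + delta) ^+ n.+1 - a ^+ n.+1 - n.+1%:R * a ^+ n.+1.-1 * delta =
  (a + delta) * ((a + delta) ^+ n - a ^+ n - n%:R * a ^+ n.-1 * delta)
   + n%:R * a ^+ n.-1 * (delta * delta).
  case: n {IH} => [|n] /=; first by rewrite !expr0 expr1; ring.
  by rewrite !exprS; ring.
apply: vgeD; rewrite -[M + M]add0r; apply: vgeM => //.
- by apply: vgeD ha _; apply: vgeW hd.
- by rewrite -[0]addr0 vgeM ?vge_nat ?vgeX0.
- exact: vgeM.
Qed.

(** Newton's method for [T ^ n - u] started at [c]: the derivative [n a ^ (n-1)] stays a unit, as
    [n] and [c] are nonzero in [k]. *)
Lemma newton_root (n : nat) u c : n%:R != 0 :> k -> c != 0 -> vge P 1 (u - emb c ^+ n) ->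
  exists a : nat -> K, [/\ forall N, a N != 0 /\ P (a N) = 0,
    null_seq P (fun N => a N ^+ n - u) & cauchy_seq P a].
Proof.
move=> n0 c0 hu.
pose step a := a - (a ^+ n - u) / (n%:R * a ^+ n.-1).
pose a N := iter N step (emb c).
have ha N : [/\ a N != 0, P (a N) = 0, vge P N.+1 (a N ^+ n - u)
    & vge P N.+1 (a N.+1 - a N)].
  have step_ok N' b : b != 0 -> P b = 0 -> vge P N'.+1 (b ^+ n - u) ->
      [/\ step b != 0, P (step b) = 0, vge P N'.+2 (step b ^+ n - u)
        & vge P N'.+1 (step b - b)].
    move=> b0 Pb hb.
    have d0 : n%:R * b ^+ n.-1 != 0.
      by rewrite mulf_neq0 ?expf_neq0 // -(rmorph_nat emb) fmorph_eq0.
    have Pd : P (n%:R * b ^+ n.-1) = 0.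
      rewrite ordM ?expf_neq0 // -?(rmorph_nat emb) ?fmorph_eq0 // ord_const //.
      by rewrite ordX // Pb mul0rn.
    have hdelta : vge P N'.+1 (- ((b ^+ n - u) / (n%:R * b ^+ n.-1))).
      by rewrite vgeN mulrC vge_unitM ?invr_eq0 // ordV // Pd oppr0.
    have vb : vge P 0 b by rewrite vgeE // Pb.
    have := @vge_taylor n b _ N'.+1 _ vb hdelta; rewrite -/(step b) => /(_ isT).
    have -> : step b ^+ n - b ^+ n - n%:R * b ^+ n.-1 * - ((b ^+ n - u) / (n%:R * b ^+ n.-1))
      = step b ^+ n - u.
      by rewrite mulrN mulrC divfK //; ring.
    move=> htay; have [] := @ordDl _ _ _ P b (- ((b ^+ n - u) / (n%:R * b ^+ n.-1))) b0.
      by apply: vgeW hdelta; rewrite Pb; lia.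
    (* The error order doubles at each step; a gain of one is enough for convergence. *)
    rewrite -/(step b) Pb => s0 Ps; split=> //; first by apply: vgeW htay; lia.
    by rewrite /step addrC addKr.
  elim: N => [|N [aN0 PaN h1 h2]].
    have e0 : emb c != 0 by rewrite fmorph_eq0.
    have h0 : vge P 1%N (emb c ^+ n - u) by rewrite -vgeN opprB.
    by have [] := step_ok 0%N _ e0 (ord_const P c0) h0; rewrite /a /= ord_const.
  have [s0 Ps s1 s2] := step_ok N _ aN0 PaN h1.
  by have [_ _ _ s3] := step_ok N.+1 _ s0 Ps s1.
exists a; split.
- by move=> N; have [] := ha N.
- by move=> M; exists `|M|%N => N hN; have [_ _ h _] := ha N; apply: vgeW h; lia.
- move=> M; exists `|M|%N => N hN; rewrite -(subnK hN).
  elim: (N - _)%N => [|N' IH]; first by rewrite add0n subrr vge0r.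
  rewrite addSn -(subrK (a (N' + `|M|)%N) (a _.+1)) -addrA; apply: vgeD IH.
  by have [_ _ _ h] := ha (N' + `|M|)%N; apply: vgeW h; lia.
Qed.

End Newton.

(** [X ^ n - 1] is separable, hence has [n] distinct roots, and a finite group of roots of unity is
    cyclic. *)
Lemma char0_prim_root (k : closedFieldType) (n : nat) : (0 < n)%N -> n%:R != 0 :> k ->
  exists z : k, n.-primitive_root z.
Proof.
move=> n_gt0 n0; have [s e] := closed_field_poly_normal ('X^n - 1 : {poly k}).
rewrite (monicP _) ?monicXnsubC // scale1r in e.
have us : uniq s.
  rewrite -separable_prod_XsubC -e separable_Xn_sub_1 //.
have : has n.-primitive_root s.
  apply: cyclic.has_prim_root => //.
    apply/allP => z zs; rewrite unity_rootE -subr_eq0.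
    have : root ('X^n - 1) z by rewrite e root_prod_XsubC.
    by rewrite rootE !hornerE.
  by rewrite -ltnS -(size_prod_XsubC s id) -e size_XnsubC.
by case/hasP => z _ hz; exists z.
Qed.

(** Orthogonality of characters; the exponent [n - j + i] represents [i - j] without a negative
    number. *)
Lemma prim_root_sum (k : fieldType) (n : nat) (z : k) (i j : nat) : (i < n)%N -> (j < n)%N ->
  n.-primitive_root z -> \sum_(l < n) z ^+ (l * (n - j + i)) = (i == j)%:R * n%:R.
Proof.
move=> lin ljn hz; set w := z ^+ (n - j + i).
have -> : \sum_(l < n) z ^+ (l * (n - j + i)) = \sum_(l < n) w ^+ l.
  by apply: eq_bigr => l _; rewrite mulnC exprM.
have w1 : w ^+ n = 1 by rewrite /w exprAC (prim_expr_order hz) expr1n.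
have [eij|neij] := eqVneq i j.
  have -> : w = 1 by rewrite /w eij subnK ?(prim_expr_order hz) // ltnW.
  by under eq_bigr do rewrite expr1n; rewrite sumr_const card_ord mul1r.
rewrite mul0r; have : (w - 1) * \sum_(l < n) w ^+ l = 0 by rewrite -subrX1 w1 subrr.
move/eqP; rewrite mulf_eq0 subr_eq0 => /orP[|/eqP//].
rewrite -(prim_order_dvd hz) => dvd; exfalso; move/eqP: neij; apply.
(* The exponent lies strictly between 0 and [2 n], so divisibility by [n] would make it [n], that is
   [i = j]. *)
move/dvdnP: dvd => [q]; case: q => [|[|q]]; rewrite ?mul0n ?mul1n ?mulSn; lia.
Qed.

(** * Coefficient estimates from the points on a parametrized branch *)

Section Parametrization.
Variables (k : closedFieldType) (K : fieldType) (emb : {rmorphism k -> K}) (x y : K).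
Variables (n : nat) (h : {poly k}).
Hypotheses (n_gt0 : (0 < n)%N) (modelK : function_field_of emb x y n h).
Hypotheses (h_neq0 : h != 0) (n_neq0 : n%:R != 0 :> k).
Variables (P : point emb) (X sigma u : K) (c b : k) (i j : nat).
Hypotheses (X_transc : forall r, r != 0 -> (map_poly emb r).[X] != 0)
  (sigma0 : sigma != 0) (c0 : c != 0)
  (hX : (map_poly emb h).[X] = sigma ^+ n * u) (hu : vge P 1 (u - emb c ^+ n))
  (bezout : P (X - emb b) *+ i - P sigma *+ j = 1).

(* The points constructed are x = X, y = z sigma a with a^n = u and z an n-th root
   of unity; averaging over z isolates each term of G. *)
Lemma parametrized_points (G : {poly {poly k}}) (e : int) : (size G <= n)%N ->
  (forall Q : point emb,
     (forall r, r != 0 -> Q (map_poly emb r).[x] = P (map_poly emb r).[X]) ->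
     vge Q e (evalXY emb x y G)) ->
  forall l, (l < n)%N -> vge P (e - P sigma *+ l) (map_poly emb G`_l).[X].
Proof.
move=> sG hG; have [a [a_unit a_root a_cauchy]] := newton_root n_neq0 c0 hu.
have [z hz] := char0_prim_root n_gt0 n_neq0.
have z0 : z != 0.
  apply/eqP => z0; have /eqP := prim_expr_order hz.
  by rewrite z0 expr0n eqn0Ngt n_gt0 eq_sym oner_eq0.
have ez0 l : emb (z ^+ l) != 0 by rewrite fmorph_eq0 expf_neq0.
(* As [a N ^ n] tends to [u], the n-th powers tend to [sigma ^ n * u = h(X)], whichever root of
   unity [z ^ l] is used. *)
pose Y l N := emb (z ^+ l) * (sigma * a N).
have evG l : exists N0, forall N, (N0 <= N)%N -> vge P e (evalXY emb X (Y l N) G).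
  have [/(evalXY_small n_gt0 modelK sG)->|G0] := eqVneq (evalXY emb x y G) 0.
    by exists 0%N => N _; rewrite rmorph0 vge0r.
  have Y_cauchy : cauchy_seq P (Y l).
    by apply: cauchyM (cauchy_const _ _) _; apply: cauchyM (cauchy_const _ _) _.
  have Y_root : null_seq P (fun N => Y l N ^+ n - (map_poly emb h).[X]).
    move=> M; have [N0 hN0] := null_mul a_root (cauchy_const P (sigma ^+ n)) M.
    exists N0 => N /hN0; rewrite hX /Y !exprMn -rmorphXn exprAC (prim_expr_order hz).
    by rewrite expr1n rmorph1 mul1r mulrC mulrBr.
  have Y_neq0 N : Y l N != 0 by have [? _] := a_unit N; rewrite !mulf_neq0.
  have Y_ord N : P (Y l N) = P sigma.
    have [a0 Pa] := a_unit N; rewrite !ordM ?mulf_neq0 // Pa addr0 ord_const ?add0r //.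
    by have := ez0 l; rewrite fmorph_eq0.
  pose Q := new_point n_gt0 modelK h_neq0 X_transc Y_cauchy Y_root Y_neq0 Y_ord bezout.
  have [e' he'] := spec_lim n_gt0 modelK X_transc Y_cauchy Y_root G0.
  have QG : Q (evalXY emb x y G) = e' by exact: new_pointE.
  have : vge Q e (evalXY emb x y G).
    apply: hG => r r0; rewrite -(evalXY_C emb x y); apply: new_pointE.
      by rewrite evalXY_C (model_transc n_gt0 modelK).
    by exists 0%N => N _; rewrite evalXY_C X_transc.
  rewrite vgeE // QG => le_e; case: he' => N0 hN0; exists N0 => N /hN0[s0 Ps].
  by rewrite vgeE // Ps.
(* A single index [N] serves all [n] branches, so the averaging takes place inside [K]. *)
have [N hN] : exists N, forall l, (l < n)%N -> vge P e (evalXY emb X (Y l N) G).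
  have [N hN] : exists N0, forall N, (N0 <= N)%N -> forall l, (l < n)%N ->
      vge P e (evalXY emb X (Y l N) G).
    elim: {1}n => [|n' [N1 h1]]; first by exists 0%N.
    have [N2 h2] := evG n'; exists (N1 + N2)%N => N hN l; rewrite ltnS leq_eqVlt.
    by case/orP => [/eqP->|lln]; [apply: h2 | apply: h1]; rewrite ?lln //; lia.
  by exists N; apply: hN.
move=> l ln; have [aN0 PaN] := a_unit N; set w := sigma * a N.
have w0 : w != 0 by rewrite mulf_neq0.
have Pw : P w = P sigma by rewrite ordM // PaN addr0.
(* Weighting branch [q] by [z ^ (- q l)] and summing kills every power of [w] except the [l]-th. *)
have key : \sum_(q < n) emb (z ^+ (q * (n - l))) * evalXY emb X (Y q N) G
    = n%:R * ((map_poly emb G`_l).[X] * w ^+ l).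
  have term (q : 'I_n) : emb (z ^+ (q * (n - l))) * evalXY emb X (Y q N) G =
      \sum_(i' < n) emb (z ^+ (q * (n - l + i'))) * ((map_poly emb G`_i').[X] * w ^+ i').
    rewrite (evalXY_sum _ _ _ sG) mulr_sumr; apply: eq_bigr => i' _.
    by rewrite /Y -/w exprMn -rmorphXn -exprM mulnDr exprD rmorphM /=; ring.
  rewrite (eq_bigr _ (fun q _ => term q)) exchange_big (bigD1 (Ordinal ln)) //=.
  rewrite -mulr_suml -rmorph_sum (@prim_root_sum _ _ _ l l) // eqxx mul1r rmorph_nat.
  rewrite big1 ?addr0 // => i' il; rewrite -mulr_suml -rmorph_sum prim_root_sum //.
  have /negPf -> : (i' : nat) != l by apply: contra_neq il => e'; apply: val_inj.
  by rewrite mul0r rmorph0 mul0r.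
have : vge P e (n%:R * ((map_poly emb G`_l).[X] * w ^+ l)).
  rewrite -key; apply: vge_sum => q _; rewrite -[e]add0r vgeM ?vge_const ?hN //.
rewrite vge_unitM; last 2 first.
- by rewrite -(rmorph_nat emb) fmorph_eq0.
- by rewrite -(rmorph_nat emb) ord_const.
move=> hv; rewrite -(mulfK (expf_neq0 l w0) (map_poly emb G`_l).[X]).
by apply: vgeM => //; rewrite vgeE ?invr_eq0 ?expf_neq0 // ordV ?expf_neq0 // ordX // Pw.
Qed.

End Parametrization.

(** * The points of the curve *)

(** The difference quotient of [p] at [c], whose value at [c] is the derivative. *)
Lemma poly_slope (k : fieldType) (p : {poly k}) c : exists2 q : {poly k},
  p - p.[c]%:P = q * ('X - c%:P) & q.[c] = p^`().[c].
Proof.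
have /factor_theorem[q e] : root (p - p.[c]%:P) c by rewrite rootE !hornerE subrr.
exists q => //; have := congr1 (fun r => r^`().[c]) e.
rewrite derivB derivC subr0 derivM derivB derivX derivC subr0 mulr1.
by rewrite hornerD hornerM hornerXsubC subrr mulr0 add0r.
Qed.

Section LocalSlope.
Variables (k K : fieldType) (emb : {rmorphism k -> K}) (P : point emb) (t u : K).
Hypothesis t0 : t != 0.

Lemma slope_eq (z : K) (p q : {poly k}) c : p - p.[c]%:P = q * ('X - c%:P) ->
  (map_poly emb p).[z] - emb p.[c] = (map_poly emb q).[z] * (z - emb c).
Proof.
move=> /(congr1 (fun r => (map_poly emb r).[z])).
rewrite rmorphB rmorphM /= map_polyXsubC map_polyC /=.
by rewrite hornerD hornerN hornerC hornerM hornerXsubC.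
Qed.

Lemma loc_slope z (p : {poly k}) c : locring P t u z -> locring P t u ((z - emb c) / t) ->
  locring P t u (((map_poly emb p).[z] - emb p.[c]) / t).
Proof.
move=> lz lzt; have [q /(slope_eq z) -> _] := poly_slope p c.
by rewrite -mulrA; apply: loc_mul => //; apply: loc_horner.
Qed.

(** As [p'(c)] is nonzero the difference quotient is a unit at [z], so divisibility by [t] passes
    from [p(z) - p(c)] back to [z - c]. *)
Lemma loc_inv_slope z (p : {poly k}) c : locring P t u z -> vge P 1 (z - emb c) ->
  p^`().[c] != 0 -> locring P t u (((map_poly emb p).[z] - emb p.[c]) / t) ->
  locring P t u ((z - emb c) / t).
Proof.
move=> lz vz; have [q /(slope_eq z) -> <-] := poly_slope p c.
move=> /(ord_horner_unit vz)[q0 Pq]; rewrite -mulrA => hl.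
rewrite -[_ / t](mulKf q0); apply: loc_mul hl.
by apply: loc_inv => //; apply: loc_horner.
Qed.

End LocalSlope.

Lemma nth_root (k : closedFieldType) n (c : k) : (0 < n)%N -> exists z, z ^+ n = c.
Proof.
move=> n_gt0; have : size ('X^n - c%:P) != 1%N by rewrite size_XnsubC // eqSS -lt0n.
by case/closed_rootP => z; rewrite rootE !hornerE subr_eq0 => /eqP; exists z.
Qed.

Lemma Posz_mulrn (i j : nat) : i%:Z *+ j = (i * j)%:Z.
Proof. by rewrite -mulr_natr natz. Qed.

Lemma sum_divmod (V : nmodType) (n m : nat) (F : nat -> nat -> V) : (0 < n)%N ->
  \sum_(q <- iota 0 (m * n)) F (q %/ n)%N (q %% n)%N = \sum_(i < m) \sum_(l < n) F i l.
Proof.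
move=> n_gt0; elim: m => [|m IH]; first by rewrite mul0n big_nil big_ord0.
rewrite mulSn addnC iotaD big_cat /= IH big_ord_recr /=; congr (_ + _).
rewrite add0n -[X in iota X _]addn0 iotaDl big_map -{1}(subn0 n) -/(index_iota 0 n) big_mkord.
by apply: eq_bigr => l _; rewrite divnMDl // modnMDl divn_small ?modn_small ?addn0.
Qed.

Section Curve.
Variables (k : closedFieldType) (K : fieldType) (emb : {rmorphism k -> K}) (x y : K).
Variables (n m : nat) (h : {poly k}).
Hypotheses (char0 : [pchar k] =i pred0) (n_gt0 : (0 < n)%N) (m_gt0 : (0 < m)%N).
Hypotheses (h_sep : separable_poly h) (h_deg : size h = m.+1).
Hypothesis (modelK : function_field_of emb x y n h).
Variables (Omega : lmodType K) (d : K -> Omega).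
Hypotheses (kaehler_d : kaehler emb d) (Omega_neq0 : exists w : Omega, w != 0).

Lemma char0_natr i : (0 < i)%N -> i%:R != 0 :> k.
Proof. by move=> i0; rewrite ((pcharf0P k).1 char0) -lt0n. Qed.

Lemma char0_natrK i : (0 < i)%N -> i%:R != 0 :> K.
Proof. by move=> /char0_natr; rewrite -(fmorph_eq0 emb) rmorph_nat. Qed.

Lemma h_neq0 : h != 0.
Proof. by rewrite -size_poly_eq0 h_deg. Qed.

Lemma h_deriv_root b : root h b -> h^`().[b] != 0.
Proof.
by move=> hb; have := h_sep; rewrite separable_poly.unlock => /coprimep_root; apply.
Qed.

Let y_neq0 : y != 0 := model_y_neq0 n_gt0 modelK h_neq0.
Let n_neq0 : n%:R != 0 :> k := char0_natr n_gt0.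
Let nK_neq0 : n%:R != 0 :> K := char0_natrK n_gt0.
Let D := derx n_gt0 modelK h_neq0 n_neq0 kaehler_d.
Let DD : forall f f', D (f + f') = D f + D f'.
Proof. exact: derxD. Qed.
Let DM : forall f f', D (f * f') = f * D f' + f' * D f.
Proof. exact: derxM. Qed.
Let DC : forall c, D (emb c) = 0.
Proof. exact: derxC. Qed.
Let Dx : D x = 1. Proof. exact: derx_x. Qed.
Let Dy : D y = (map_poly emb h^`()).[x] / (n%:R * y ^+ n.-1).
Proof. exact: derx_y. Qed.
Let Dder : derivation emb (D : K -> K^o).
Proof. exact: derx_derivation. Qed.

Lemma x_sub_neq0 b : x - emb b != 0.
Proof.
have := model_transc n_gt0 modelK (negbT (polyXsubC_eq0 b)).
by rewrite map_polyXsubC hornerXsubC.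
Qed.

Lemma loc_all_frac (P : point emb) t u : locfrac P t u x -> locfrac P t u y ->
  forall f, locfrac P t u f.
Proof.
move=> lx ly f; have lr r : locfrac P t u (map_poly emb r).[x].
  elim/poly_ind: r => [|r c IH].
    by rewrite rmorph0 horner0; apply: locfrac_loc; rewrite -(rmorph0 emb); constructor.
  rewrite rmorphD rmorphM /= map_polyX map_polyC /= !hornerE.
  by apply: locfracD; [apply: locfracM | apply: locfrac_loc; constructor].
have lp p : locfrac P t u (evalXY emb x y p).
  elim/poly_ind: p => [|p r IH].
    by rewrite rmorph0 -(horner0 x) -(rmorph0 (map_poly emb)); exact: lr.
  rewrite rmorphD rmorphM /= evalXY_X evalXY_C.
  by apply: locfracD => //; apply: locfracM.
have [p [q [q0 ->]]] := modelK.2 f.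
by apply: locfracM => //; apply: locfracV.
Qed.

(** The checklist for each kind of point: the conditions on [t] and [u] say that they present the
    valuation ring and that [D / D t] preserves it; then [dx] has order [- P (D t)]. *)
Lemma locdiff_coordinates (P : point emb) t u c : t != 0 -> 0 < P t ->
  vge P 1 (u - emb c) -> locring P t u ((u - emb c) / t) ->
  D t != 0 -> locring P t u (D u / D t) -> locfrac P t u x -> locfrac P t u y ->
  P t = 1 /\ locdiff x d P (- P (D t)).
Proof.
move=> t0 Pt vu lu Dt0 lDu lx ly; have frac := loc_all_frac lx ly.
have Pt1 := loc_uniformizer t0 Pt vu lu frac; split=> //.
by apply: locdiff_uniformizer => // f; exact: (vge_derive t0 Pt vu lu frac DD DM DC Dt0 lDu).
Qed.

(** Otherwise [x] is regular with no residue in [k], so every nonzero [r(x)] is a unit, hence so is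
    [y]. By norms every nonzero polynomial in [x] and [y] is then a unit, and no element has order
    1. *)
Lemma point_cases (P : point emb) : (exists b, vge P 1 (x - emb b)) \/ (x != 0 /\ P x < 0).
Proof.
apply: NNPP => /not_or_and[no_b no_pole].
have vx : vge P 0 x.
  rewrite /vge; case: eqP => //= /eqP x0; rewrite leNgt; apply/negP => Px; exact: no_pole.
have Pr r : r != 0 -> P (map_poly emb r).[x] = 0.
  move=> r0; have ex0 := model_transc n_gt0 modelK r0.
  apply/eqP; rewrite eq_le -[X in _ && X](vgeE P) // vge_horner // andbT leNgt.
  apply/negP => lt; case: (@residue_root _ _ _ P x r r0); first by rewrite vgeE.
  by move=> c _ hc; apply: no_b; exists c.
have Py : P y = 0.
  have := Pr h h_neq0; rewrite -(model_y modelK) ordX // => /eqP.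
  by rewrite -mulr_natr mulf_eq0 pnatr_eq0 (gtn_eqF n_gt0) orbF => /eqP.
have vp p : vge P 0 (evalXY emb x y p).
  elim/poly_ind: p => [|p r IH]; first by rewrite rmorph0 vge0r.
  rewrite rmorphD rmorphM /= evalXY_X evalXY_C vgeD ?vge_horner //.
  by rewrite -[0]addr0 vgeM // vgeE ?Py.
have Pp p : evalXY emb x y p != 0 -> P (evalXY emb x y p) = 0.
  move=> p0; have [s [r [r0 e]]] := evalXY_norm n_gt0 modelK p0.
  have es : evalXY emb x y p * evalXY emb x y s != 0.
    by rewrite -rmorphM /= e (model_transc n_gt0 modelK).
  have s0 : evalXY emb x y s != 0 by move: es; rewrite mulf_eq0 negb_or => /andP[].
  have := Pr r r0; have := vp p; have := vp s; rewrite -e rmorphM /= ordM // !vgeE //.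
  by move: (P (evalXY emb x y p)) (P (evalXY emb x y s)); clear; lia.
have [f f0 Pf] := ord_uniformizer P; have [p [q [q0 e]]] := modelK.2 f.
have p0 : evalXY emb x y p != 0 by move: f0; rewrite e mulf_eq0 negb_or => /andP[].
by move: Pf; rewrite e ord_div // !Pp.
Qed.

(** Take [t = x - b] and [u = y]. The residue [c] of [y] is an n-th root of [h(b)], hence a simple
    root of [X ^ n - h(b)], which makes [y - c] divisible by [t]. *)
Lemma nonroot_point (P : point emb) b : vge P 1 (x - emb b) -> h.[b] != 0 ->
  [/\ P (x - emb b) = 1, P y = 0 & locdiff x d P 0].
Proof.
move=> vb hb; set t := x - emb b; have t0 : t != 0 := x_sub_neq0 b.
have vhx := horner_specialize h vb.
have [hx0 Phx] := ord_horner_unit vb hb.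
have Py : P y = 0.
  move/eqP: Phx; rewrite -(model_y modelK) ordX //.
  by rewrite -mulr_natr mulf_eq0 pnatr_eq0 (gtn_eqF n_gt0) orbF => /eqP.
pose r : {poly k} := 'X^n - h.[b]%:P.
have ery : (map_poly emb r).[y] = y ^+ n - emb h.[b].
  by rewrite rmorphB rmorphXn /= map_polyX map_polyC /= !hornerE.
have [c rc vc] : exists2 c, root r c & vge P 1 (y - emb c).
  apply: residue_root; first by rewrite monic_neq0 ?monicXnsubC.
  by rewrite ery (model_y modelK).
have rc0 : r.[c] = 0 by move: rc; rewrite rootE => /eqP.
have cn : c ^+ n = h.[b] by move: rc0; rewrite !hornerE => /eqP; rewrite subr_eq0 => /eqP.
have c0 : c != 0 by apply: contraNneq hb => c0; rewrite -cn c0 expr0n eqn0Ngt n_gt0.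
have Dt : D t = 1.
  have -> : t = x + emb (- b) by rewrite rmorphN.
  by rewrite DD DC addr0 Dx.
have lx : locring P t y x by rewrite -[x](subrK (emb b)); apply: loc_add; constructor.
have lyt : locring P t y ((y - emb c) / t).
  apply: (@loc_inv_slope _ _ _ _ _ _ _ r) => //; first by constructor.
    by rewrite derivB derivC subr0 derivXn hornerMn hornerXn -mulr_natr mulf_neq0 ?expf_neq0.
  rewrite rc0 rmorph0 subr0 ery (model_y modelK); apply: loc_slope => //.
  by rewrite divff //; exact: loc1.
have lDy : locring P t y (D y / D t).
  rewrite Dt divr1 Dy; apply: loc_mul; first exact: loc_horner.
  apply: loc_inv.
  - by apply: loc_mul; [rewrite -(rmorph_nat emb); constructor | apply: loc_exp; constructor].
  - by rewrite mulf_neq0 // expf_neq0.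
  - rewrite ordM ?expf_neq0 // ordX // Py mul0rn addr0 -(rmorph_nat emb).
    exact: ord_const.
have Pt : 0 < P t by move: vb; rewrite vgeE.
have Dt0 : D t != 0 by rewrite Dt oner_eq0.
have [] // := locdiff_coordinates t0 Pt vc lyt Dt0 lDy.
- exact: locfrac_loc.
- by apply: locfrac_loc; constructor.
- by rewrite Dt ord_one oppr0.
Qed.

(** Take [t = y] and [u = x]. As [b] is a simple root of [h], [x - b] is a unit times
    [h(x) = y ^ n]; and [dy / dx = h'(x) / (n y ^ (n-1))] has order [- (n - 1)]. *)
Lemma root_point (P : point emb) b : vge P 1 (x - emb b) -> root h b ->
  [/\ P (x - emb b) = n%:Z, P y = 1 & locdiff x d P n.-1%:Z].
Proof.
move=> vb hb; have hb0 : h.[b] = 0 by move: hb; rewrite rootE => /eqP.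
have Py : 0 < P y.
  have := horner_specialize h vb; rewrite hb0 rmorph0 subr0 -(model_y modelK).
  by rewrite vgeE ?expf_neq0 // ordX //; nia.
have h'b := h_deriv_root hb; have [h'x0 Ph'x] := ord_horner_unit vb h'b.
have Dy0 : D y != 0.
  by rewrite Dy mulf_neq0 ?invr_eq0 // mulf_neq0 // expf_neq0.
have lxt : locring P y x ((x - emb b) / y).
  apply: (@loc_inv_slope _ _ _ _ _ _ _ h) => //; first by constructor.
  rewrite hb0 rmorph0 subr0 -(model_y modelK) -(prednK n_gt0) exprSr mulfK //.
  by apply: loc_exp; constructor.
have lDx : locring P y x (D x / D y).
  rewrite Dx Dy mul1r invf_div; apply: loc_mul.
    by apply: loc_mul; [rewrite -(rmorph_nat emb); constructor | apply: loc_exp; constructor].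
  by apply: loc_inv => //; apply: loc_horner; constructor.
have [||Py1] := locdiff_coordinates y_neq0 Py vb lxt Dy0 lDx.
- by apply: locfrac_loc; constructor.
- by apply: locfrac_loc; constructor.
rewrite Dy ord_div //; last by rewrite mulf_neq0 ?expf_neq0.
rewrite Ph'x ordM ?expf_neq0 // ordX // Py1 -(rmorph_nat emb) ord_const //.
rewrite !add0r opprK natz => hdiff; split=> //.
have [q e qb] := poly_slope h b; rewrite -qb in h'b.
have [qx0 Pqx] := ord_horner_unit vb h'b.
have := slope_eq emb x e; rewrite hb0 rmorph0 subr0 -(model_y modelK) => /(congr1 P).
by rewrite ordX // Py1 ordM ?x_sub_neq0 // Pqx add0r => <-; rewrite natz.
Qed.

Let DX f i : D (f ^+ i) = i%:R * f ^+ i.-1 * D f.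
Proof. exact: (derivationX Dder). Qed.
Let Dhorner z r : D (map_poly emb r).[z] = (map_poly emb r^`()).[z] * D z.
Proof. exact: (derivation_horner Dder). Qed.

(** The reciprocal polynomial of [h]: the equation at infinity in terms of [1 / x]. Its constant
    term is the leading coefficient of [h]. *)
Definition rev_h : {poly k} := \poly_(i < m.+1) h`_(m - i).

Lemma rev_h0 : rev_h.[0] != 0.
Proof.
rewrite horner_coef0 coef_poly subn0 /=.
have -> : h`_m = lead_coef h by rewrite lead_coefE h_deg.
by rewrite lead_coef_eq0 h_neq0.
Qed.

Lemma horner_rev_h z : z != 0 ->
  (map_poly emb h).[z] = z ^+ m * (map_poly emb rev_h).[z^-1].
Proof.
move=> z0; rewrite (@horner_coef_wide _ m.+1) ?size_map_poly ?h_deg //.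
rewrite (@horner_coef_wide _ m.+1 (map_poly emb rev_h)) ?size_map_poly ?size_poly //.
rewrite mulr_sumr (reindex_inj rev_ord_inj) /=; apply: eq_bigr => i _.
rewrite !coef_map coef_poly ltn_ord subSS /= mulrCA; congr (_ * _).
have le_im : (i <= m)%N by rewrite -ltnS.
have -> : z ^+ m = z ^+ (m - i) * z ^+ i by rewrite -exprD subnK.
by rewrite exprVn mulfK // expf_neq0.
Qed.

Section GcdDecomposition.
Variables (dl n' m' A B : nat).
Hypotheses (dl_gt0 : (0 < dl)%N) (n_eq : n = (n' * dl)%N) (m_eq : m = (m' * dl)%N)
  (bezout : (B * m' = (A * n').+1)%N).

(** With [t = x ^ A / y ^ B] and [u = y ^ n' / x ^ m'], Bezout gives [1 / x = t ^ n' * u ^ B] and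
    [1 / y = t ^ m' * u ^ A], while [u ^ dl = rev_h(1 / x)]. So the residue of [u] is a simple root
    of [X ^ dl - rev_h(0)]. *)
Lemma infinity_point (P : point emb) : x != 0 -> P x < 0 ->
  [/\ P x = - n'%:Z, P y = - m'%:Z & locdiff x d P (- (n'.+1%:Z))].
Proof.
move=> x0 Px.
have n'_gt0 : (0 < n')%N by move: n_gt0; rewrite n_eq; case: (n').
have B_gt0 : (0 < B)%N by move: bezout; case: (B).
have Pyx : P y * n'%:Z = P x * m'%:Z.
  have [_ ] := ord_horner_pole x0 Px h_neq0.
  rewrite -(model_y modelK) ordX // h_deg /= -[P y *+ n]mulr_natr -[P x *+ m]mulr_natr !natz.
  rewrite n_eq m_eq !PoszM !mulrA => e.
  have dl0 : dl%:Z != 0 by rewrite eqz_nat -lt0n.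
  exact: (mulIf dl0).
set z := x^-1; have z0 : z != 0 by rewrite invr_eq0.
pose t := x ^+ A / y ^+ B; pose u := y ^+ n' / x ^+ m'.
have t0 : t != 0 by rewrite mulf_neq0 ?invr_eq0 ?expf_neq0.
have u0 : u != 0 by rewrite mulf_neq0 ?invr_eq0 ?expf_neq0.
have Ptx : P t * n'%:Z = - P x.
  rewrite ord_div ?expf_neq0 // !ordX // -[P x *+ A]mulr_natr -[P y *+ B]mulr_natr !natz.
  have e : B%:Z * m'%:Z = A%:Z * n'%:Z + 1 by rewrite -!PoszM bezout; lia.
  have -> : (P x * A%:Z - P y * B%:Z) * n'%:Z =
    P x * (A%:Z * n'%:Z) - P y * n'%:Z * B%:Z by ring.
  have -> : P y * n'%:Z * B%:Z = P x * (B%:Z * m'%:Z) by rewrite Pyx; ring.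
  by rewrite e; ring.
have Pt : 0 < P t by nia.
have Pu : P u = 0.
  rewrite ord_div ?expf_neq0 // !ordX // -[P x *+ m']mulr_natr -[P y *+ n']mulr_natr !natz.
  by rewrite Pyx subrr.
have z_tu : z = t ^+ n' * u ^+ B.
  rewrite /z /t /u !expr_div_n -!exprM [(m' * B)%N]mulnC bezout [(n' * B)%N]mulnC exprS.
  by field; rewrite x0 !expf_neq0.
have y_tu : y^-1 = t ^+ m' * u ^+ A.
  rewrite /t /u !expr_div_n -!exprM bezout [(n' * A)%N]mulnC [(m' * A)%N]mulnC exprS.
  by field; rewrite y_neq0 !expf_neq0.
have u_dl : u ^+ dl = (map_poly emb rev_h).[z].
  rewrite /u expr_div_n -!exprM -n_eq -m_eq (model_y modelK) horner_rev_h //.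
  by rewrite mulrC mulKf // expf_neq0.
have vz : vge P 1 (z - emb 0) by rewrite rmorph0 subr0 vgeE // ordV //; lia.
pose r : {poly k} := 'X^dl - rev_h.[0]%:P.
have eru : (map_poly emb r).[u] = u ^+ dl - emb rev_h.[0].
  by rewrite rmorphB rmorphXn /= map_polyX map_polyC /= !hornerE.
have [c rc vc] : exists2 c, root r c & vge P 1 (u - emb c).
  apply: residue_root; first by rewrite monic_neq0 ?monicXnsubC.
  by rewrite eru u_dl; exact: horner_specialize.
have rc0 : r.[c] = 0 by move: rc; rewrite rootE => /eqP.
have c_dl : c ^+ dl = rev_h.[0].
  by move: rc0; rewrite !hornerE => /eqP; rewrite subr_eq0 => /eqP.
have c0 : c != 0.
  by apply: contraNneq rev_h0 => c0; rewrite -c_dl c0 expr0n eqn0Ngt dl_gt0.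
have lt : locring P t u t by constructor.
have lu : locring P t u u by constructor.
have lz : locring P t u z by rewrite z_tu; apply: loc_mul; apply: loc_exp.
have lzt : locring P t u (z / t).
  have -> : z / t = t ^+ n'.-1 * u ^+ B by rewrite z_tu -{1}(prednK n'_gt0) exprS; field.
  by apply: loc_mul; apply: loc_exp.
have lut : locring P t u ((u - emb c) / t).
  apply: (@loc_inv_slope _ _ _ _ _ _ _ r) => //.
    rewrite derivB derivC subr0 derivXn hornerMn hornerXn -mulr_natr.
    by rewrite mulf_neq0 ?expf_neq0 ?char0_natr.
  rewrite rc0 rmorph0 subr0 eru u_dl; apply: loc_slope => //.
  by rewrite rmorph0 subr0.
set H' := (map_poly emb rev_h^`()).[z].
have lH' : locring P t u H' by apply: loc_horner.
have n'K0 : n'%:R != 0 :> K := char0_natrK n'_gt0.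
have dlK0 : dl%:R != 0 :> K := char0_natrK dl_gt0.
have lnat i : locring P t u i%:R by rewrite -(rmorph_nat emb); constructor.
have Pnat i : (0 < i)%N -> P i%:R = 0.
  by move=> /char0_natr i0; rewrite -(rmorph_nat emb) ord_const.
have Dz : D z = - z ^+ 2.
  by have := derivationV Dder x0; rewrite -/z => ->; rewrite Dx exprVn /GRing.scale /= mulr1.
have Du : D u = - z ^+ 2 * H' / (dl%:R * u ^+ dl.-1).
  have c1 : dl%:R * u ^+ dl.-1 != 0 by rewrite mulf_neq0 // expf_neq0.
  apply: (mulfI c1); rewrite -DX u_dl Dhorner Dz -/H' mulrC.
  by rewrite [RHS]mulrC divfK.
(* This factor comes from differentiating [z = t ^ n' * u ^ B], which gives
   [D t = - t z kappa / n']. Since [z] vanishes at [P], [kappa] has residue 1, so [D t] has order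
   [n' + 1]. *)
pose kappa := 1 - B%:R * z * H' / (dl%:R * u ^+ dl).
have ludl i : locring P t u (u ^+ i)^-1.
  apply: loc_inv; [exact: loc_exp | by rewrite expf_neq0 |].
  by rewrite ordX // Pu mul0rn.
have ldl : locring P t u dl%:R^-1 by apply: loc_inv => //; exact: Pnat.
have lkappa : locring P t u kappa.
  apply: loc_add; first exact: loc1.
  apply: loc_opp; rewrite invfM; do ! apply: loc_mul => //.
have [kappa0 Pkappa] : kappa != 0 /\ P kappa = 0.
  apply: (@ord_unit_of_residue _ _ _ P _ 1); first exact: oner_neq0.
  rewrite rmorph1 /kappa addrC addKr vgeN.
  have -> : B%:R * z * H' / (dl%:R * u ^+ dl) =
      (z - emb 0) * (B%:R * H' * dl%:R^-1 * (u ^+ dl)^-1).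
    by rewrite rmorph0 subr0; field; rewrite dlK0 expf_neq0.
  rewrite -[1]addr0 vgeM //; apply: (loc_vge (t := t) (u := u) (c := c)) => //.
  by do ! apply: loc_mul => //.
have Dt : D t = - (t * z * kappa) / n'%:R.
  have c1 : u ^+ B * (n'%:R * t ^+ n'.-1) != 0 by rewrite !mulf_neq0 ?expf_neq0.
  have zu : t ^+ n' * u ^+ B.-1 = z / u.
    by rewrite z_tu -{2}(prednK B_gt0) exprSr mulrA mulfK.
  have zt : u ^+ B * t ^+ n'.-1 = z / t.
    by rewrite z_tu -{2}(prednK n'_gt0) exprSr mulrAC mulfK // mulrC.
  have udl : u ^+ dl = u ^+ dl.-1 * u by rewrite -{1}(prednK dl_gt0) exprSr.
  apply: (mulfI c1).
  have -> : u ^+ B * (n'%:R * t ^+ n'.-1) * D t = D z - t ^+ n' * u ^+ B.-1 * (B%:R * D u).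
    by rewrite {1}z_tu DM !DX; ring.
  have -> : u ^+ B * (n'%:R * t ^+ n'.-1) = u ^+ B * t ^+ n'.-1 * n'%:R by ring.
  rewrite zu zt Dz Du /kappa udl; field.
  by rewrite t0 u0 n'K0 dlK0 expf_neq0.
have tzk0 := mulf_neq0 (mulf_neq0 t0 z0) kappa0.
have Dt0 : D t != 0.
  by rewrite Dt; apply: mulf_neq0; rewrite ?invr_eq0 ?oppr_eq0 ?tzk0.
have lDu : locring P t u (D u / D t).
  have -> : D u / D t = z / t * (H' * n'%:R * (dl%:R^-1 * (u ^+ dl.-1)^-1 * kappa^-1)).
    by rewrite Du Dt; field; rewrite oppr_eq0 kappa0 dlK0 t0 n'K0 expf_neq0 // tzk0.
  do ! apply: loc_mul => //.
  by apply: loc_inv.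
have [||Pt1] := locdiff_coordinates t0 Pt vc lut Dt0 lDu.
- by rewrite -[x]invrK; apply: locfracV; apply: locfrac_loc.
- rewrite -[y]invrK; apply: locfracV; apply: locfrac_loc; rewrite y_tu.
  by apply: loc_mul; apply: loc_exp.
have Pxn : P x = - n'%:Z by move: Ptx; rewrite Pt1 mul1r => ->; rewrite opprK.
have Pz : P z = n'%:Z by rewrite ordV // Pxn opprK.
have -> : P (D t) = n'.+1%:Z.
  rewrite Dt ord_div ?oppr_eq0 // (ordN P tzk0).
  rewrite (ordM P (mulf_neq0 t0 z0) kappa0) (ordM P t0 z0).
  by rewrite Pt1 Pkappa Pz Pnat // subr0 addr0 -intS.
move=> hdiff; split=> //.
have n'0 : n'%:Z != 0 by rewrite eqz_nat -lt0n.
by apply: (mulIf n'0); rewrite Pyx Pxn !mulNr mulrC.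
Qed.

Variable P : point emb.

(** * Holomorphic differentials *)

(* The points over [x = b] are reached by x = b + s (resp. x = b + s^n if [b] is a
   root of h), where s is a local parameter at [P]. *)
Lemma affine_coef_root b (G : {poly {poly k}}) : (size G <= n)%N ->
  (forall Q : point emb, vge Q 1 (x - emb b) ->
     vge Q (Q (x - emb b)) (evalXY emb x y G)) ->
  forall l, (l < n)%N -> root G`_l b.
Proof.
move=> sG hG l ln; have [s s0 Ps] := ord_uniformizer P.
have shift E : E != 0 -> 0 < P E -> forall r, r != 0 -> (map_poly emb r).[E + emb b] != 0.
  move=> E0 PE r r0; apply: (ord_horner_zero (P := P) (b := b)) => //; by rewrite addrK.
have sub_eq X : (map_poly emb ('X - b%:P)).[X] = X - emb b.
  by rewrite map_polyXsubC hornerXsubC.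
have conclude E : E != 0 -> 0 < P E ->
    vge P 1 (map_poly emb G`_l).[E + emb b] -> root G`_l b.
  move=> E0 PE; apply: contraLR; rewrite rootE => Gb.
  have [] := @ord_horner_unit _ _ _ P (E + emb b) b G`_l _ Gb.
    by rewrite addrK vgeE //; lia.
  by move=> G0 PG; rewrite vgeE // PG.
have [hb|hb] := boolP (root h b); last first.
  have sP : 0 < P s by rewrite Ps.
  apply: (conclude s) => //.
  have vs : vge P 1 (s + emb b - emb b) by rewrite addrK vgeE // Ps.
  have [c ec] := nth_root h.[b] n_gt0.
  have c0 : c != 0.
    by apply: contraNneq hb => c0; rewrite rootE -ec c0 expr0n eqn0Ngt n_gt0.
  have := @parametrized_points k K emb x y n h n_gt0 modelK h_neq0 n_neq0 P (s + emb b) 1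
    (map_poly emb h).[s + emb b] c b 1 0 (shift s s0 sP) (oner_neq0 _) c0.
  rewrite expr1n mul1r -rmorphXn ec addrK Ps => /(_ erefl (horner_specialize h vs) erefl).
  move=> /(_ G 1 sG) => /(_ _ l ln); rewrite ord_one mul0rn subr0; apply=> Q hQ.
  have Qx : Q (x - emb b) = 1.
    by rewrite -sub_eq hQ ?polyXsubC_eq0 // sub_eq addrK.
  by have := hG Q; rewrite vgeE ?x_sub_neq0 // Qx; apply.
(* At a root, [h = q * (X - b)] gives [h(b + s ^ n) = s ^ n * q(b + s ^ n)] with [q(b) = h'(b)]
   nonzero: [sigma] is [s], and Bezout reads [n - (n - 1) = 1]. *)
have [q eq qb] := poly_slope h b; rewrite (eqP hb) in eq.
have q0 : q.[b] != 0 by rewrite qb h_deriv_root.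
have sn0 : s ^+ n != 0 by rewrite expf_neq0.
have Psn : P (s ^+ n) = n%:Z by rewrite ordX // Ps natz.
have sP : 0 < P (s ^+ n) by rewrite Psn.
apply: (conclude (s ^+ n)) => //.
have vs : vge P 1 (s ^+ n + emb b - emb b) by rewrite addrK vgeE // Psn.
have [c ec] := nth_root q.[b] n_gt0.
have c0 : c != 0.
  by apply: contraNneq q0 => c0; rewrite -ec c0 expr0n eqn0Ngt n_gt0.
have hX : (map_poly emb h).[s ^+ n + emb b] = s ^+ n * (map_poly emb q).[s ^+ n + emb b].
  have := congr1 (fun r => (map_poly emb r).[s ^+ n + emb b]) eq.
  by rewrite subr0 rmorphM /= hornerM sub_eq addrK mulrC.
have bez : P (s ^+ n + emb b - emb b) *+ 1 - P s *+ n.-1 = 1.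
  by rewrite addrK Psn Ps natz; clear -n_gt0; lia.
have := @parametrized_points k K emb x y n h n_gt0 modelK h_neq0 n_neq0 P (s ^+ n + emb b) s
  (map_poly emb q).[s ^+ n + emb b] c b 1 n.-1 (shift _ sn0 sP) s0 c0 hX.
rewrite -rmorphXn ec => /(_ (horner_specialize q vs) bez G n%:Z sG) => /(_ _ l ln) hl.
have {}hl : vge P (n%:Z - P s *+ l) (map_poly emb G`_l).[s ^+ n + emb b].
  apply: hl => Q hQ.
  have Qx : Q (x - emb b) = n%:Z.
    by rewrite -sub_eq hQ ?polyXsubC_eq0 // sub_eq addrK.
  by have := hG Q; rewrite vgeE ?x_sub_neq0 // Qx; apply.
(* The bound obtained is [n - l], at least 1 because [l < n]. *)
by apply: vgeW hl; rewrite Ps natz; clear -ln; lia.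
Qed.

(** Descent on the degree of the denominator [E]: at a root [b] of [E] every coefficient of the
    numerator also vanishes, and [X - b] cancels. *)
Lemma affine_regular_poly f :
  (forall (Q : point emb) b, vge Q 1 (x - emb b) -> vge Q 0 f) ->
  exists2 G : {poly {poly k}}, (size G <= n)%N & f = evalXY emb x y G.
Proof.
move=> reg; have [E [G [E0 sG e]]] := normal_form n_gt0 modelK f.
have [N] := ubnP (size E); elim: N E E0 G sG e => // N IH E E0 G sG e ltN.
have [sE|sE] := leqP (size E) 1.
  have eE := size1_polyC sE; have c0 : E`_0 != 0 by rewrite eE polyC_eq0 in E0.
  exists (((E`_0)^-1)%:P%:P * G).
    by apply: leq_trans sG; rewrite mul_polyC size_scale // polyC_eq0 invr_eq0.
  rewrite rmorphM /= -e evalXY_C map_polyC hornerC eE map_polyC hornerC /= coefC eqxx.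
  by rewrite fmorphV mulrC mulfK // fmorph_eq0.
have /closed_rootP[b Eb] : size E != 1%N by rewrite gtn_eqF.
have [E' eE] := factor_theorem E b Eb.
have subE : (map_poly emb ('X - b%:P)).[x] = x - emb b.
  by rewrite map_polyXsubC hornerXsubC.
have rootG : forall l, (l < n)%N -> root G`_l b.
  apply: (affine_coef_root sG) => Q hQ; rewrite -e eE rmorphM /= hornerM subE mulrA.
  have vx : vge Q 0 x.
    by rewrite -[x](subrK (emb b)); apply: vgeD; [exact: vgeW hQ | exact: vge_const].
  rewrite -[Q _]add0r vgeM //; last by rewrite vgeE ?x_sub_neq0.
  by rewrite -[0]addr0 vgeM ?vge_horner // (reg Q b).
pose G' : {poly {poly k}} := \poly_(l < n) (G`_l %/ ('X - b%:P)).
have sG' : (size G' <= n)%N by apply: size_poly.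
have E'0 : E' != 0 by apply: contra_neq E0 => E'0; rewrite eE E'0 mul0r.
apply: (IH E' E'0 G' sG').
  apply: (mulIf (x_sub_neq0 b)); rewrite -mulrA -subE.
  rewrite -hornerM -rmorphM -eE e (evalXY_sum _ _ _ sG) (evalXY_sum _ _ _ sG') mulr_suml.
  apply: eq_bigr => l _; rewrite coef_poly ltn_ord mulrAC -hornerM -rmorphM divpK //.
  by rewrite dvdp_XsubCl rootG.
move: ltN; rewrite eE size_Mmonic ?monicXsubC // size_XsubC; clear; lia.
Qed.

Lemma infinity_coef_degree e (G : {poly {poly k}}) : (size G <= n)%N ->
  (forall Q : point emb, x != 0 -> Q x = - n'%:Z -> vge Q e (evalXY emb x y G)) ->
  forall l, (l < n)%N -> G`_l != 0 -> e + (m' * l)%:Z <= - (n' * (size G`_l).-1)%:Z.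
Proof.
move=> sG hG l ln G0; have [s s0 Ps] := ord_uniformizer P.
have n'_gt0 : (0 < n')%N by move: n_gt0; rewrite n_eq; case: (n').
(* From [n' m = m' n], putting [X = s ^ (- n')] and [sigma = s ^ (- m')] yields
   [h(X) = sigma ^ n * rev_h(s ^ n')]. *)
pose X := s ^- n'; have X0 : X != 0 by rewrite invr_eq0 expf_neq0.
have PX : P X = - n'%:Z by rewrite ordV ?expf_neq0 // ordX // Ps natz.
have PX0 : P X < 0 by rewrite PX oppr_lt0 ltz_nat.
have X_transc r : r != 0 -> (map_poly emb r).[X] != 0.
  by move=> r0; have [] := ord_horner_pole X0 PX0 r0.
pose sigma := s ^- m'; have sigma0 : sigma != 0 by rewrite invr_eq0 expf_neq0.
have Psigma : P sigma = - m'%:Z by rewrite ordV ?expf_neq0 // ordX // Ps natz.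
have [c ec] := nth_root rev_h.[0] n_gt0.
have c0 : c != 0.
  by apply: contraNneq rev_h0 => c0; rewrite -ec c0 expr0n eqn0Ngt n_gt0.
have hX : (map_poly emb h).[X] = sigma ^+ n * (map_poly emb rev_h).[s ^+ n'].
  rewrite horner_rev_h // invrK; congr (_ * _).
  by rewrite !exprVn -!exprM {1}m_eq n_eq mulnCA.
have hu : vge P 1 ((map_poly emb rev_h).[s ^+ n'] - emb c ^+ n).
  rewrite -rmorphXn ec; apply: horner_specialize.
  by rewrite rmorph0 subr0 vgeE ?expf_neq0 // ordX // Ps natz.
have bez : P (X - emb 0) *+ A - P sigma *+ B = 1.
  rewrite rmorph0 subr0 PX Psigma !mulNrn opprK !Posz_mulrn.
  by rewrite [(m' * B)%N]mulnC bezout mulnC; clear; lia.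
have := parametrized_points n_gt0 modelK h_neq0 n_neq0 X_transc sigma0
  c0 hX hu bez sG (e := e).
move=> /(_ _ l ln) hl; have : vge P (e - P sigma *+ l) (map_poly emb G`_l).[X].
  apply: hl => Q hQ; apply: hG.
    by have := x_sub_neq0 0; rewrite rmorph0 subr0.
  by have := hQ 'X (negbT (polyX_eq0 _)); rewrite map_polyX !hornerX PX.
have [GX0 PGX] := ord_horner_pole X0 PX0 G0; rewrite vgeE // PGX PX Psigma.
rewrite !mulNrn opprK -[n'%:Z *+ _]mulr_natr -[m'%:Z *+ _]mulr_natr !natz.
by rewrite -!PoszM.
Qed.

Let dx_neq0 : d x != 0 := dx_neq0 n_gt0 modelK h_neq0 n_neq0 kaehler_d Omega_neq0.
Let dx_span : forall w, exists f, w = f *: d x :=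
  differential_span n_gt0 modelK h_neq0 n_neq0 kaehler_d Omega_neq0.

Lemma locdiff_unique (Q : point emb) kappa kappa' :
  locdiff x d Q kappa -> locdiff x d Q kappa' -> kappa = kappa'.
Proof.
move=> /(_ 1 (Q 1 + kappa) (oner_neq0 _))[_ /(_ erefl) h1].
by move=> /(_ 1 (Q 1 + kappa) (oner_neq0 _))[/(_ h1) /addrI].
Qed.

Lemma locdiff_ex (Q : point emb) : exists kappa, locdiff x d Q kappa.
Proof.
have [[b vb]|[x0 Qx]] := point_cases Q.
  have [hb|hb] := boolP (root h b).
    by have [_ _ hd] := root_point vb hb; eexists; exact: hd.
  by have [_ _ hd] := nonroot_point vb hb; eexists; exact: hd.
by have [_ _ hd] := infinity_point x0 Qx; eexists; exact: hd.
Qed.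

(** Holomorphy of [f dx] as a bound on the order of [f], in a form that includes [f = 0]. *)
Definition regular f := forall (Q : point emb) kappa, locdiff x d Q kappa -> vge Q (- kappa) f.

Lemma regular0 : regular 0.
Proof. by move=> Q kappa _; exact: vge0r. Qed.

Lemma holomorphicE f : holomorphic emb d (f *: d x) <-> regular f.
Proof.
have [->|f0] := eqVneq f 0.
  by split=> _; [exact: regular0 | left; rewrite scale0r].
split=> [[/eqP e|holo] Q kappa hQ|reg].
- by move: e; rewrite scaler_eq0 (negPf f0) (negPf dx_neq0).
- by have [e e0 /(hQ _ _ f0) he] := holo Q; rewrite vgeE //; move: e0; rewrite -he; clear; lia.
- right=> Q; have [kappa hQ] := locdiff_ex Q; exists (Q f + kappa); last exact/hQ.
  by have := reg Q kappa hQ; rewrite vgeE //; clear; lia.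
Qed.

(** The factor [y ^ (n-1)] clears the poles allowed above the roots of [h], so the product is a
    polynomial. At infinity the order bound reads [n' * size G_l < m' * (n - 1 - l)]; multiply by
    [dl]. *)
Lemma regular_numerator f : regular f -> exists G : {poly {poly k}},
  [/\ (size G <= n)%N, f * y ^+ n.-1 = evalXY emb x y G
    & forall l, (l < n)%N -> G`_l != 0 -> (n * size (G`_l)%R < m * (n.-1 - l))%N].
Proof.
move=> reg; have [|G sG eG] := @affine_regular_poly (f * y ^+ n.-1).
  move=> Q b vb; have [hb|hb] := boolP (root h b).
    have [_ Qy /reg hf] := root_point vb hb.
    by rewrite -(addNr n.-1%:Z) vgeM // vgeE ?expf_neq0 // ordX // Qy natz.
  have [_ Qy /reg hf] := nonroot_point vb hb.
  by rewrite oppr0 in hf; rewrite -[0]addr0 vgeM // vgeX0 // vgeE // Qy.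
exists G; split=> // l ln Gl0.
have hinf (Q : point emb) : x != 0 -> Q x = - n'%:Z ->
    vge Q (n'.+1%:Z - (m' * n.-1)%:Z) (evalXY emb x y G).
  move=> x0 Qx; have Qx0 : Q x < 0.
    by rewrite Qx oppr_lt0 ltz_nat; move: n_gt0; rewrite n_eq; case: (n').
  have [_ Qy /reg] := infinity_point x0 Qx0.
  rewrite opprK -eG => hf; apply: vgeM => //.
  by rewrite vgeE ?expf_neq0 // ordX // Qy mulNrn PoszM -mulr_natr natz.
have := infinity_coef_degree sG hinf ln Gl0.
have : (0 < size (G`_l)%R)%N by rewrite size_poly_gt0.
rewrite n_eq m_eq mulnAC [in X in _ -> _ -> (_ < X)%N]mulnAC ltn_mul2r dl_gt0 -n_eq /=.
move: (size _) => s; case: s => [//|s] _ /=; rewrite mulnS mulnBr.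
have : (m' * l <= m' * n.-1)%N by rewrite leq_mul2l; apply/orP; right; clear -ln; lia.
move: (m' * l)%N (m' * n.-1)%N (n' * s)%N => u v w; clear; lia.
Qed.

(** * The monomial differentials and the orders they take *)

Variable a : k.

(** Over a root the order of [f] is at least [l - (n - 1)], over other finite points at least 0. At
    infinity it is [m' (n - 1 - l) - n' i], and the condition says that this is at least
    [n' + 1]. *)
Lemma regular_monomial i l : (n * i.+1 < m * (n.-1 - l))%N ->
  regular ((x - emb a) ^+ i * y ^+ l / y ^+ n.-1).
Proof.
move=> cond Q kappa hQ.
have f0 : (x - emb a) ^+ i * y ^+ l / y ^+ n.-1 != 0.
  by rewrite !mulf_neq0 ?invr_eq0 ?expf_neq0 ?x_sub_neq0.
have xa0 := x_sub_neq0 a.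
rewrite vgeE // ord_div ?ordM ?mulf_neq0 ?expf_neq0 // !ordX //.
have [[b vb]|[x0 Qx]] := point_cases Q.
  have : vge Q 0 (x - emb a).
    rewrite -[x](subrK (emb b)) -addrA -rmorphB.
    by apply: vgeD; [exact: vgeW vb | exact: vge_const].
  rewrite vgeE // => Qxa; have Qi : 0 <= Q (x - emb a) *+ i by rewrite mulrn_wge0.
  have [hb|hb] := boolP (root h b).
    have [_ Qy hQ'] := root_point vb hb; rewrite (locdiff_unique hQ hQ') Qy !natz.
    by move: Qi; clear; lia.
  have [_ Qy hQ'] := nonroot_point vb hb; rewrite (locdiff_unique hQ hQ') Qy !mul0rn.
  by move: Qi; clear; lia.
have [Qx' Qy hQ'] := infinity_point x0 Qx.
rewrite (locdiff_unique hQ hQ') opprK Qy.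
have Qxa : Q (x - emb a) = - n'%:Z.
  have := ord_horner_pole x0 Qx (negbT (polyXsubC_eq0 a)).
  by rewrite map_polyXsubC hornerXsubC size_XsubC mulr1n Qx' => -[].
rewrite Qxa !mulNrn !Posz_mulrn.
move: cond; rewrite n_eq m_eq mulnAC [in X in (_ < X)%N -> _]mulnAC ltn_mul2r dl_gt0 -n_eq /=.
rewrite mulnS mulnBr.
by move: (m' * l)%N (m' * n.-1)%N (n' * i)%N => u v w; clear; lia.
Qed.

(* [q] stands for the exponents i = q / n and l = q mod n. *)
Definition order_cond q := (n * (q %/ n).+1 < m * (n.-1 - q %% n))%N.
(** The range loses nothing: for [n > 0] the condition gives [q < n (q / n + 1) < m n]. *)
Definition orders := [seq q <- iota 0 (m * n) | order_cond q].
Definition eta q := (x - emb a) ^+ (q %/ n) * y ^+ (q %% n) / y ^+ n.-1.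

Lemma orders_uniq : uniq orders.
Proof. by rewrite filter_uniq // iota_uniq. Qed.

Lemma eta_regular q : q \in orders -> regular (eta q).
Proof. by rewrite mem_filter => /andP[hq _]; apply: regular_monomial. Qed.

Lemma regular_span f : regular f -> exists c : nat -> k,
  f = \sum_(q <- orders) emb (c q) * eta q.
Proof.
move=> /regular_numerator[G [sG eG degG]].
(* The coefficient of [(X - a) ^ i] in the expansion of [G_l] around [a]. If it is nonzero then
   [i < size G_l], and the degree bound on [G_l] becomes [order_cond]. *)
pose c i l := (G`_l \Po ('X + a%:P))`_i.
have c_cond q : c (q %/ n)%N (q %% n)%N != 0 -> order_cond q.
  set l := (q %% n)%N; set i := (q %/ n)%N => ci; have ln : (l < n)%N by rewrite ltn_mod.
  have ltis : (i < size (G`_l)%R)%N.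
    rewrite ltnNge; apply: contra ci => le_si; rewrite /c nth_default //.
    by rewrite size_comp_poly2 ?size_XaddC.
  have Gl0 : G`_l != 0 by rewrite -size_poly_gt0 (leq_trans _ ltis).
  by apply: leq_ltn_trans (degG l ln Gl0); rewrite leq_mul2l ltis orbT.
exists (fun q => c (q %/ n)%N (q %% n)%N).
rewrite /orders big_filter big_mkcond /=.
have yn0 : y ^+ n.-1 != 0 by rewrite expf_neq0.
transitivity (\sum_(q <- iota 0 (m * n)) emb (c (q %/ n)%N (q %% n)%N) * eta q); last first.
  apply: eq_bigr => q _; case: ifPn => // /negP hq.
  have [->|/c_cond//] := eqVneq (c (q %/ n)%N (q %% n)%N) 0.
  by rewrite rmorph0 mul0r.
rewrite /eta (sum_divmod _
  (fun i l => emb (c i l) * ((x - emb a) ^+ i * y ^+ l / y ^+ n.-1))) //.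
apply: (mulIf yn0); rewrite eG (evalXY_sum _ _ _ sG) exchange_big mulr_suml /=.
apply: eq_bigr => l _.
have sl : (size (G`_l \Po ('X + a%:P))%R <= m)%N.
  rewrite size_comp_poly2 ?size_XaddC //.
  have [->|Gl0] := eqVneq G`_l 0; first by rewrite size_poly0.
  have le_n : (m * (n.-1 - l) <= m * n)%N.
    by rewrite leq_mul2l (leq_trans (leq_subr _ _) (leq_pred n)) orbT.
  have := leq_trans (degG l (ltn_ord l) Gl0) le_n.
  by rewrite mulnC ltn_mul2r => /andP[_ /ltnW].
have -> : (map_poly emb G`_l).[x] = (map_poly emb (G`_l \Po ('X + a%:P))).[x - emb a].
  rewrite map_comp_poly rmorphD /= map_polyX map_polyC /= horner_comp !hornerE.
  by rewrite subrK.
rewrite (@horner_coef_wide _ m) ?size_map_poly // !mulr_suml; apply: eq_bigr => i _.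
by rewrite coef_map /= /c; field.
Qed.

Hypotheses (ha : root h a) (va : vge P 1 (x - emb a)).

Lemma eta_neq0 q : eta q != 0.
Proof. by rewrite !mulf_neq0 ?invr_eq0 ?expf_neq0 ?x_sub_neq0. Qed.

Lemma eta_ord q : P (eta q) = q%:Z - n.-1%:Z.
Proof.
have [Px Py _] := root_point va ha; have xa0 := x_sub_neq0 a.
rewrite ord_div ?mulf_neq0 ?expf_neq0 // ordM ?expf_neq0 // !ordX // Px Py !natz.
by rewrite -mulr_natr natz -PoszM -PoszD mulnC -divn_eq.
Qed.

(* The orders at [P] of the [eta q] are pairwise distinct. *)
Lemma eta_sum_ord (s : seq nat) (c : nat -> k) : uniq s ->
  (forall q, q \in s -> c q = 0) \/
  (exists2 q, q \in s & \sum_(i <- s) emb (c i) * eta i != 0 /\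
     P (\sum_(i <- s) emb (c i) * eta i) = q%:Z - n.-1%:Z).
Proof.
elim: s => [|q s IH] /=; first by left.
case/andP=> qs us; rewrite big_cons; have [cq|cq] := eqVneq (c q) 0.
  rewrite cq rmorph0 mul0r add0r; have [h0|[r rs hr]] := IH us.
    by left=> i; rewrite inE => /orP[/eqP->|/h0].
  by right; exists r; rewrite // inE rs orbT.
have t0 : emb (c q) * eta q != 0 by rewrite mulf_neq0 ?fmorph_eq0 // eta_neq0.
have Pt : P (emb (c q) * eta q) = q%:Z - n.-1%:Z.
  by rewrite ordM ?fmorph_eq0 ?eta_neq0 // ord_const // add0r eta_ord.
right; have [h0|[r rs [T0 PT]]] := IH us.
  exists q; first by rewrite mem_head.
  rewrite big_seq big1 ?addr0 // => i /h0 ->.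
  by rewrite rmorph0 mul0r.
set T := \sum_(j <- s) _ in T0 PT *.
have qr : q != r by apply: contraNneq qs => ->.
have [qr'|rq] : (q < r)%N \/ (r < q)%N by move: qr; clear; lia.
  exists q; rewrite ?mem_head // -Pt; apply: ordDl => //.
  by rewrite vgeE // Pt PT; move: qr'; clear; lia.
exists r; rewrite ?inE ?rs ?orbT // -PT addrC; apply: ordDl => //.
by rewrite vgeE // Pt PT; move: rq; clear; lia.
Qed.

(** At [P] the differential [dx] has order [n - 1], which cancels the shift in [eta_ord]: [eta q dx]
    has order [q]. A combination takes the order of one of its terms, since these orders are
    distinct. *)
Lemma holomorphic_orders e : (e \in [seq Posz q | q <- orders]) <->
  exists w, [/\ w != 0, holomorphic emb d w & diff_ord d P w e].
Proof.
have [_ _ hP] := root_point va ha; split.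
  case/mapP=> q hq ->; exists (eta q *: d x); split.
  - by rewrite scaler_eq0 negb_or eta_neq0.
  - exact/holomorphicE/eta_regular.
  - by apply/hP; rewrite ?eta_neq0 // eta_ord subrK.
case=> w [w0 hw we]; have [f ef] := dx_span w.
move: hw w0 we; rewrite ef => /holomorphicE /regular_span[c ec].
rewrite scaler_eq0 negb_or => /andP[f0 _] /(hP _ _ f0) <-.
have [h0|[q qs [_ Pq]]] := eta_sum_ord c orders_uniq.
  case/eqP: f0; rewrite ec big_seq big1 // => q /h0 ->.
  by rewrite rmorph0 mul0r.
by rewrite ec Pq subrK; apply: map_f.
Qed.

(** The family [b] and the family [eta q dx] express each other by matrices [M] and [N], which turn
    out to be mutually inverse. *)
Lemma genus_orders g : has_genus emb d g -> size orders = g.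
Proof.
case=> b [hb bspan]; set r := size orders.
have bc i : exists c : nat -> k, b i = (\sum_(q <- orders) emb (c q) * eta q) *: d x.
  have [f ef] := dx_span (b i); have := hb i; rewrite ef => /holomorphicE /regular_span[c ec].
  by exists c; rewrite -ec.
pose cb i := sval (constructive_indefinite_description _ (bc i)).
have cbE i : b i = (\sum_(q <- orders) emb (cb i q) * eta q) *: d x.
  by rewrite /cb; case: constructive_indefinite_description.
pose M : 'M[k]_(g, r) := \matrix_(i, j) cb i (nth 0%N orders j).
have bM i : b i = \sum_(j < r) (emb (M i j) * eta (nth 0%N orders j)) *: d x.
  rewrite cbE (big_nth 0%N) big_mkord scaler_suml.
  by apply: eq_bigr => j _; rewrite mxE.
have ec (j : 'I_r) : exists c : 'rV[k]_g,
    eta (nth 0%N orders j) *: d x = \sum_(i < g) emb (c 0 i) *: b i.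
  have [|c [hc _]] := bspan (eta (nth 0%N orders j) *: d x).
    by apply/holomorphicE/eta_regular; rewrite mem_nth.
  by exists c.
pose ce (j : 'I_r) := sval (constructive_indefinite_description _ (ec j)).
have ceE (j : 'I_r) : eta (nth 0%N orders j) *: d x = \sum_(i < g) emb (ce j 0 i) *: b i.
  by rewrite /ce; case: constructive_indefinite_description.
pose N : 'M[k]_(r, g) := \matrix_(j, i) ce j 0 i.
(* Uniqueness of coordinates with respect to [b]. *)
have MN : M *m N = 1%:M.
  apply/matrixP => i i'; have [|c [_ cuniq]] := bspan (b i); first exact: hb.
  have e1 : b i = \sum_(l < g) emb ((M *m N) i l) *: b l.
    under eq_bigr do rewrite mxE rmorph_sum scaler_suml.
    rewrite exchange_big {1}bM; apply: eq_bigr => j _.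
    rewrite -scalerA ceE scaler_sumr; apply: eq_bigr => l _.
    by rewrite scalerA rmorphM [N _ _]mxE.
  have e2 : b i = \sum_(l < g) emb ((1%:M : 'M[k]_g) i l) *: b l.
    rewrite (bigD1 i) //= mxE eqxx rmorph1 scale1r big1 ?addr0 // => l li.
    by rewrite mxE eq_sym (negPf li) rmorph0 scale0r.
  have c1 := cuniq (row i (M *m N)); have c2 := cuniq (row i 1%:M).
  have : row i (M *m N) = row i 1%:M.
    rewrite -c1 ?c2 //.
      by rewrite {1}e2; apply: eq_bigr => l _; rewrite [row _ _ _ _]mxE.
    by rewrite {1}e1; apply: eq_bigr => l _; rewrite [row _ _ _ _]mxE.
  by move/rowP/(_ i'); rewrite [LHS]mxE [RHS]mxE.
(* Independence of the [eta q] over [k]: a row of [N *m M - 1%:M], reindexed by exponents as [cc],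
   is a vanishing combination, and a nontrivial one would have an order at [P]. *)
have NM : N *m M = 1%:M.
  apply/matrixP => j j'; apply/eqP; rewrite -subr_eq0.
  pose cc q := if (q \in orders) then
    (N *m M - 1%:M) j (insubd j (index q orders)) else 0.
  have ccE (l : 'I_r) : cc (nth 0%N orders l) = (N *m M - 1%:M) j l.
    rewrite /cc mem_nth // index_uniq ?orders_uniq //; congr (_ j _).
    by apply: val_inj; rewrite val_insubd ltn_ord.
  have sum0 : \sum_(q <- orders) emb (cc q) * eta q = 0.
    rewrite (big_nth 0%N) big_mkord.
    have : (\sum_(l < r) emb ((N *m M - 1%:M) j l) * eta (nth 0%N orders l)) *: d x = 0.
      have -> : \sum_(l < r) emb ((N *m M - 1%:M) j l) * eta (nth 0%N orders l) =
        \sum_(l < r) emb ((N *m M) j l) * eta (nth 0%N orders l) - eta (nth 0%N orders j).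
        under eq_bigr => l _ do rewrite [X in emb X]mxE [X in _ + X]mxE rmorphB mulrBl.
        rewrite sumrB; congr (_ - _); rewrite (bigD1 j) //= mxE eqxx rmorph1 mul1r.
        by rewrite big1 ?addr0 // => l lj; rewrite mxE eq_sym (negPf lj) rmorph0 mul0r.
      rewrite scalerBl ceE scaler_suml; apply/eqP; rewrite subr_eq0; apply/eqP.
      under eq_bigr do rewrite mxE rmorph_sum mulr_suml scaler_suml.
      rewrite exchange_big; apply: eq_bigr => i _; rewrite bM scaler_sumr.
      by apply: eq_bigr => l _; rewrite rmorphM scalerA mulrA [N _ _]mxE.
    move/eqP; rewrite scaler_eq0 (negPf dx_neq0) orbF => /eqP e0.
    by rewrite -[RHS]e0; apply: eq_bigr => l _; rewrite ccE.
  have [h0|[q _ [/eqP]]] := eta_sum_ord cc orders_uniq; last by rewrite sum0.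
  by have := h0 _ (mem_nth 0%N (ltn_ord j')); rewrite ccE !mxE => ->.
by apply/eqP; rewrite eqn_leq (mulmx1_min NM) (mulmx1_min MN).
Qed.

End GcdDecomposition.
End Curve.

(** * Vanishing sequences *)

Lemma orders_sorted n m : sorted ltn (orders n m).
Proof. by apply: sorted_filter; [exact: ltn_trans | exact: iota_ltn_sorted]. Qed.

Lemma mem_orders n m q : (q \in orders n m) = order_cond n m q && (q < m * n)%N.
Proof. by rewrite mem_filter mem_iota. Qed.

(** For [q < n] the condition is [n < 2 (n - 1 - q)], that is [2 q < n - 2]. For [q >= n] the left
    side is at least [2 n], beyond the right side. *)
Lemma orders_deg2 n : (0 < n)%N -> orders n 2 = iota 0 n.-1./2.
Proof.
move=> n_gt0; apply: (irr_sorted_eq ltn_trans ltnn).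
- exact: orders_sorted.
- exact: iota_ltn_sorted.
move=> q; rewrite mem_orders mem_iota /order_cond /= add0n.
have [ltqn|leqn] := ltnP q n; first by rewrite divn_small // modn_small //; lia.
have : (n <= n * (q %/ n))%N by rewrite leq_pmulr // divn_gt0.
by rewrite mulnS; move: (n * _)%N (q %% n)%N => u v; lia.
Qed.

(** [n - 1] is never an order, as the right side of the condition is then zero; a generic sequence
    would therefore stop before [n]. But [n] is an order as soon as [2 n < m (n - 1)]. *)
Lemma orders_not_generic n m : (2 <= n)%N -> (3 <= m)%N -> (2 <= size (orders n m))%N ->
  orders n m <> iota 0 (size (orders n m)).
Proof.
move=> n2 m3 s2 e.
have nmem : n.-1 \notin orders n m.
  by rewrite mem_orders /order_cond modn_small ?subnn ?muln0 ?ltn0 //; lia.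
have le_s : (size (orders n m) <= n.-1)%N.
  by move: nmem; rewrite e mem_iota size_iota /= add0n -leqNgt.
have [big|small] := ltnP (2 * n) (m * n.-1).
  have : n \in orders n m.
    rewrite mem_orders /order_cond divnn modnn subn0 (_ : (0 < n)%N) /=; last by lia.
    by rewrite mulnC big ltn_Pmull; lia.
  by rewrite e mem_iota /= add0n; lia.
(* Otherwise (n, m) is (2, 3), (2, 4) or (3, 3), where there are fewer than two orders. *)
have n3 : (n <= 3)%N by nia.
have m4 : (m <= 4)%N by nia.
move: s2 {e nmem le_s}.
by case: n n2 small n3 => [|[|[|[|]]]] //; case: m m3 m4 => [|[|[|[|[|]]]]].
Qed.

Lemma vanishing_sequence_unique (k K : fieldType) (emb : {rmorphism k -> K})
    (Omega : lmodType K) (d : K -> Omega) g (P : point emb) s s' :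
  vanishing_sequence d g P s -> vanishing_sequence d g P s' -> s = s'.
Proof.
move=> [_ s_sorted hs] [_ s'_sorted hs']; apply: lt_sorted_eq => // e.
by apply/idP/idP => [/hs/hs'|/hs'/hs].
Qed.

(** If the first basis element were zero, the zero vector and the first unit vector would both be
    its coordinates. *)
Lemma has_genus_nontrivial (k K : fieldType) (emb : {rmorphism k -> K})
    (Omega : lmodType K) (d : K -> Omega) g :
  has_genus emb d g -> (0 < g)%N -> exists w : Omega, w != 0.
Proof.
case: g => // g [b [hb bspan]] _; exists (b ord0); apply/eqP => b0.
have [c [_ cuniq]] := bspan (b ord0) (hb ord0).
have c1 := cuniq 0; have c2 := cuniq (delta_mx 0 ord0).
have : (0 : 'rV[k]_g.+1) = delta_mx 0 ord0.
  rewrite -c1 ?c2 //.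
    rewrite (bigD1 ord0) //= mxE !eqxx rmorph1 scale1r big1 ?addr0 // => i i0.
    by rewrite mxE (negPf i0) rmorph0 scale0r.
  by rewrite b0 big1 // => i _; rewrite mxE rmorph0 scale0r.
by move/rowP/(_ ord0)/eqP; rewrite !mxE !eqxx eq_sym oner_eq0.
Qed.

Theorem theorem3p7 (k : closedFieldType) (char0 : [pchar k] =i pred0)
    (n m : nat) (n_ge2 : (2 <= n)%N) (m_ge2 : (2 <= m)%N)
    (h : {poly k}) (h_sep : separable_poly h) (h_deg : size h = m.+1)
    (K : fieldType) (emb : {rmorphism k -> K}) (x y : K)
    (modelK : function_field_of emb x y n h)
    (Omega : lmodType K) (d : K -> Omega) (kaehler_d : kaehler emb d)
    (g : nat) (genus_g : has_genus emb d g) (g_ge2 : (2 <= g)%N)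
    (P : point emb)
    (P_above_root : exists2 a : k, root h a & 0 < ord P (x - emb a)) :
  (weierstrass_point d g P <-> (3 <= m)%N) /\
  (m = 2%N -> vanishing_sequence d g P (generic_sequence g)).
Proof.
have n_gt0 : (0 < n)%N by lia.
have m_gt0 : (0 < m)%N by lia.
have Omega_neq0 := has_genus_nontrivial genus_g (ltnW g_ge2).
have [a ha Pa] := P_above_root.
have va : vge P 1 (x - emb a) by rewrite /vge -gtz0_ge1 ?Pa ?orbT.
have dl_gt0 : (0 < gcdn m n)%N by rewrite gcdn_gt0 m_gt0.
have n_eq : n = (n %/ gcdn m n * gcdn m n)%N by rewrite divnK // dvdn_gcdr.
have m_eq : m = (m %/ gcdn m n * gcdn m n)%N by rewrite divnK // dvdn_gcdl.
(* Extended Euclid gives [B m = A n + gcd(m, n)]; dividing by the gcd yields the exponents of the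
   parameter at infinity. *)
have [B A bez _] := egcdnP n m_gt0.
have bezout : (B * (m %/ gcdn m n) = (A * (n %/ gcdn m n)).+1)%N.
  apply/eqP; rewrite -(eqn_pmul2r dl_gt0) mulSn -!mulnA -m_eq -n_eq bez.
  by rewrite addnC.
have sizeE : size (orders n m) = g.
  exact: (genus_orders char0 n_gt0 m_gt0 h_sep h_deg modelK kaehler_d Omega_neq0
    dl_gt0 n_eq m_eq bezout ha va genus_g).
have vanish : vanishing_sequence d g P [seq Posz q | q <- orders n m].
  split; first by rewrite size_map.
    by rewrite sorted_map; apply: sub_sorted (orders_sorted n m) => i j.
  exact: (holomorphic_orders char0 n_gt0 m_gt0 h_sep h_deg modelK kaehler_d Omega_neq0
    dl_gt0 n_eq m_eq bezout ha va).
have generic2 : m = 2%N -> [seq Posz q | q <- orders n m] = generic_sequence g.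
  move=> m2; rewrite /generic_sequence -sizeE m2 orders_deg2 //.
  by rewrite size_iota.
split; last by move=> m2; rewrite -generic2.
split=> [[s [hs s_gen]]|m3].
  (* With [m >= 2], failure of [3 <= m] means [m = 2], where the unique vanishing sequence is the
     generic one. *)
  have [//|m_lt3] := leqP 3 m; case: s_gen.
  by rewrite (vanishing_sequence_unique hs vanish) generic2 //; lia.
exists [seq Posz q | q <- orders n m]; split=> //.
have inj_Posz : injective Posz by move=> i j [].
move/(inj_map inj_Posz); rewrite -sizeE; apply: orders_not_generic => //.
by rewrite sizeE.
Qed.
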